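(* Let $(M,g)$ be an $n$-dimensional pseudo-Riemannian manifold of index $q\in\{1,\dots,n-2\}$ (e.g. a Lorentzian manifold of dimension $n\geq 3$). Let $A\neq M$ be a closed subset of $M$. Then there exists a metric $g'$ of index $q$ on $M$ such that (1) $g=g'$ on $A$; (2) every $g$-timelike vector in $TM$ is $g'$-timelike; (3) $M\setminus A$ does not admit any codimension-$q$ foliation none of whose tangent vectors is $g'$-timelike; in particular, $(M,g')$ does not admit any space foliation.
   Context: Manifolds have no boundary; all manifolds, metrics and foliations are smooth. A pseudo-Riemannian metric on an $n$-manifold is a nondegenerate symmetric bilinear form field of constant index (number of negative directions) in $\{1,\dots,n-1\}$; Lorentzian means index $1$. A tangent vector $v$ is $g$-timelike if $g(v,v)<0$, and spacelike if $g(v,v)>0$. A space foliation on a pseudo-Riemannian manifold of index $q$ is a codimension-$q$ foliation all of whose nonzero tangent vectors (vectors tangent to the leaves) are spacelike. Leaves of foliations are not required to be embedded submanifolds. *)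

(* Defs.v *)
From mathcomp Require Import all_boot all_order all_algebra.
From mathcomp Require Import all_classical all_reals all_analysis.

Set Implicit Arguments.
Unset Strict Implicit.
Unset Printing Implicit Defensive.

Import Order.TTheory GRing.Theory Num.Theory.
Import numFieldNormedType.Exports.

Local Open Scope classical_set_scope.
Local Open Scope ring_scope.

(* C^infinity on an open set U: every iterated directional derivative of f is
   (Frechet) differentiable at every point of U. *)
Definition smooth_on (R : realType) (V W : normedModType R)
    (U : set V) (f : V -> W) : Prop :=
  forall (vs : seq V) (x : V), U x ->
    differentiable (foldr (fun (v : V) (h : V -> W) => 'D_v h) f vs) x.

(* A homeomorphism between an open set of M and an open set of R^n.  Both maps
   are total functions; their values outside the two open sets are junk. *)
Record chart (R : realType) (n : nat) (M : topologicalType) := Chart {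
  cdom : set M;
  cmap : M -> 'rV[R]_n;
  cinv : 'rV[R]_n -> M;
  cdom_open : open cdom;
  cimg_open : open (cmap @` cdom);
  cmapK : forall p, cdom p -> cinv (cmap p) = p;
  cmap_continuous : {within cdom, continuous cmap};
  cinv_continuous : {within cmap @` cdom, continuous cinv} }.

Definition trans (R : realType) (n : nat) (M : topologicalType)
    (c c' : chart R n M) : 'rV[R]_n -> 'rV[R]_n :=
  fun x => cmap c' (cinv c x).

Definition trans_dom (R : realType) (n : nat) (M : topologicalType)
    (c c' : chart R n M) : set 'rV[R]_n :=
  cmap c @` (cdom c `&` cdom c').

Definition compatible (R : realType) (n : nat) (M : topologicalType)
    (c c' : chart R n M) : Prop :=
  smooth_on (trans_dom c c') (trans c c') /\
  smooth_on (trans_dom c' c) (trans c' c).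

(* The smooth structure is a maximal atlas. *)
Record smoothManifold (R : realType) (n : nat) := SmoothManifold {
  msort :> topologicalType;
  msort_hausdorff : hausdorff_space msort;
  msort_second_countable : @second_countable msort;
  atlas : set (chart R n msort);
  atlas_cover : forall p : msort, exists2 c, atlas c & cdom c p;
  atlas_compatible : forall c c', atlas c -> atlas c' -> compatible c c';
  atlas_maximal : forall c,
    (forall c', atlas c' -> compatible c c') -> atlas c }.

(* A tangent vector at tv_base, presented by its components tv_coord in some
   chart at tv_base.  In another chart c' at tv_base the same vector has the
   components 'd (trans c c') (c tv_base) tv_coord; all predicates on tangent
   vectors below are invariant under this change of presentation. *)
Record tangent_vector (R : realType) (n : nat) (M : smoothManifold R n) :=
  TangentVector {
    tv_base : M;
    tv_chart : chart R n M;
    tv_chart_atlas : atlas tv_chart;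
    tv_chart_base : cdom tv_chart tv_base;
    tv_coord : 'rV[R]_n }.

Definition tv_coord_in (R : realType) (n : nat) (M : smoothManifold R n)
    (v : tangent_vector M) (c : chart R n M) : 'rV[R]_n :=
  'd (trans (tv_chart v) c) (cmap (tv_chart v) (tv_base v)) (tv_coord v).

Definition bform (R : realType) (n : nat) (G : 'M[R]_n) (v w : 'rV[R]_n) : R :=
  (v *m G *m w^T) 0 0.

Definition nondegenerate_form (R : realType) (n : nat) (G : 'M[R]_n) : Prop :=
  forall v, (forall w, bform G v w = 0) -> v = 0.

(* The row space of W. *)
Definition negative_definite_on (R : realType) (n k : nat)
    (G : 'M[R]_n) (W : 'M[R]_(k, n)) : Prop :=
  forall v : 'rV[R]_n, (v <= W)%MS -> v != 0 -> bform G v v < 0.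

(* q is the maximal dimension of a negative definite subspace. *)
Definition has_index (R : realType) (n : nat) (G : 'M[R]_n) (q : nat) : Prop :=
  (exists W : 'M[R]_(q, n), row_free W /\ negative_definite_on G W) /\
  (forall (k : nat) (W : 'M[R]_(k, n)),
     row_free W -> negative_definite_on G W -> (k <= q)%N).

(* A smooth field of nondegenerate symmetric bilinear forms of index q:
   metric_mx c p is the Gram matrix at p in the chart c. *)
Record metric (R : realType) (n : nat) (M : smoothManifold R n) (q : nat) :=
  Metric {
    metric_mx :> chart R n M -> M -> 'M[R]_n;
    metric_sym : forall c p, atlas c -> cdom c p ->
      forall v w, bform (metric_mx c p) v w = bform (metric_mx c p) w v;
    metric_nondegenerate : forall c p, atlas c -> cdom c p ->
      nondegenerate_form (metric_mx c p);
    metric_index : forall c p, atlas c -> cdom c p ->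
      has_index (metric_mx c p) q;
    metric_trans : forall c c' p, atlas c -> atlas c' ->
      cdom c p -> cdom c' p -> forall v w : 'rV[R]_n,
      bform (metric_mx c p) v w =
      bform (metric_mx c' p) ('d (trans c c') (cmap c p) v)
                             ('d (trans c c') (cmap c p) w);
    metric_smooth : forall c, atlas c ->
      smooth_on (cmap c @` cdom c) (fun x => metric_mx c (cinv c x)) }.

Definition metric_sq (R : realType) (n : nat) (M : smoothManifold R n)
    (q : nat) (g : metric M q) (v : tangent_vector M) : R :=
  bform (g (tv_chart v) (tv_base v)) (tv_coord v) (tv_coord v).

Definition timelike (R : realType) (n : nat) (M : smoothManifold R n)
    (q : nat) (g : metric M q) (v : tangent_vector M) : Prop :=
  metric_sq g v < 0.

Definition spacelike (R : realType) (n : nat) (M : smoothManifold R n)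
    (q : nat) (g : metric M q) (v : tangent_vector M) : Prop :=
  0 < metric_sq g v.

Definition metric_eq_on (R : realType) (n : nat) (M : smoothManifold R n)
    (q : nat) (A : set M) (g g' : metric M q) : Prop :=
  forall c p, atlas c -> cdom c p -> A p -> g c p = g' c p.

(* Equality of the last q coordinates in R^n = R^(n-q) x R^q. *)
Definition eq_transverse (R : realType) (n q : nat) (x y : 'rV[R]_n) : Prop :=
  forall i : 'I_n, (n - q <= i)%N -> x 0 i = y 0 i.

(* A smooth codimension-q foliation of the open submanifold U of M, given by a
   foliated atlas: the transition maps have locally the form
   (x, y) |-> (h1(x, y), h2(y)) with respect to R^n = R^(n-q) x R^q.  The leaves
   are the maximal connected unions of overlapping plaques, a plaque being given
   by constancy of the last q coordinates of a foliated chart. *)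
Record foliation (R : realType) (n : nat) (M : smoothManifold R n)
    (q : nat) (U : set M) := Foliation {
  fol_atlas : set (chart R n M);
  fol_atlas_sub : fol_atlas `<=` @atlas R n M;
  fol_atlas_cover : \bigcup_(c in fol_atlas) cdom c = U;
  fol_atlas_trans : forall c c', fol_atlas c -> fol_atlas c' ->
    forall x, trans_dom c c' x ->
    exists2 N, nbhs x N & forall y z, N y -> N z ->
      eq_transverse q y z -> eq_transverse q (trans c c' y) (trans c c' z) }.

(* The leaf through a point agrees near it with a plaque of any foliated chart
   c, so its tangent space is R^(n-q) x 0 in c. *)
Definition tangent_to (R : realType) (n : nat) (M : smoothManifold R n)
    (q : nat) (U : set M) (F : foliation q U) (v : tangent_vector M) : Prop :=
  exists c, [/\ fol_atlas F c, cdom c (tv_base v)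
              & eq_transverse q (tv_coord_in v c) 0].

Definition space_foliation (R : realType) (n : nat) (M : smoothManifold R n)
    (q : nat) (g : metric M q) (F : foliation q [set: M]) : Prop :=
  forall v : tangent_vector M,
    tangent_to F v -> tv_coord v != 0 -> spacelike g v.

(* Main.v *)
(* Let p lie outside A, let P be a maximal positive definite subspace of T_p M
   and choose q linear forms with kernel P.  In a chart at p add
   s dt - t ds to one of them, where (s, t) are linear coordinates on a plane of
   P; call the resulting one-forms omega_1, ..., omega_q.  Set
   g' = g - f (omega_1^2 + ... + omega_q^2) with a bump function f >= 0 supported
   near p.  Since g is positive definite on the common kernel of the omega_i,
   g' still has index q.

   If f is large on a smaller ball, an (n - q)-plane field without g'-timelike
   vectors is there uniformly close to the common kernel of the omega_i.  So a
   leaf of a codimension-q foliation without g'-timelike tangent vectors meets a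
   slice in the graph of a function u over a whole square of the (s, t)-plane:
   local leaves exist over disks of uniform size by compactness, and a leaf over
   a disk extends to a slightly larger concentric disk.  Along a triangle 0,
   (a, 0), (0, a) the distinguished component of u changes by the integral of
   t ds - s dt, of modulus a^2, up to an error small compared with a^2.  But u
   returns to its initial value. *)
Require Import Defs.
From HB Require Import structures.
From mathcomp Require Import all_boot all_order all_algebra.
From mathcomp Require Import all_classical all_reals all_analysis.
From mathcomp Require Import ring lra zify.

Set Implicit Arguments.
Unset Strict Implicit.
Unset Printing Implicit Defensive.

Import Order.TTheory GRing.Theory Num.Theory.
Import numFieldNormedType.Exports.

Local Open Scope classical_set_scope.
Local Open Scope ring_scope.

(** * Bilinear forms *)

Section BilinearForms.
Variable R : realType.
Implicit Types (n q k : nat).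

(** Subtracting nonnegative multiples of squares can only lower [g(v, v)], so (1) and (2) are
    immediate, and the work lies in (3). The bound [q <= n - 2] is what gives P a plane.

    The obstacle in (3) is that a foliation is only an atlas and a leaf might leave the chart before
    it closes up over a triangle. The argument therefore works with level sets of transverse
    coordinates alone. For [b <= 1/4] and [eps <= 1/8] the cone condition makes every local leaf a
    graph of slope at most 1, so a leaf through the origin over a disk of radius below b stays in
    the box of size b. Neither an integration theorem nor a derivative of u is used: the integral of
    s dt - t ds along a segment from v to w is the constant [det2 v w], and a mean value inequality
    does the rest.

    The constants are fixed in the order r (positivity on the common kernel), b (size of the box),
    eps (opening of the cone), C (height of the bump). There is no circle, since the one-forms do
    not depend on C. *)

Lemma bformDl n (G : 'M[R]_n) u v w :
  bform G (u + v) w = bform G u w + bform G v w.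
Proof. by rewrite /bform !mulmxDl mxE. Qed.

Lemma bformDr n (G : 'M[R]_n) u v w :
  bform G u (v + w) = bform G u v + bform G u w.
Proof. by rewrite /bform linearD mulmxDr mxE. Qed.

Lemma bformZl n (G : 'M[R]_n) a v w : bform G (a *: v) w = a * bform G v w.
Proof. by rewrite /bform -!scalemxAl mxE. Qed.

Lemma bformZr n (G : 'M[R]_n) a v w : bform G v (a *: w) = a * bform G v w.
Proof. by rewrite /bform linearZ -scalemxAr mxE. Qed.

Lemma bform0l n (G : 'M[R]_n) w : bform G 0 w = 0.
Proof. by rewrite /bform !mul0mx mxE. Qed.

Lemma bformNr n (G : 'M[R]_n) v w : bform G v (- w) = - bform G v w.
Proof. by rewrite -scaleN1r bformZr mulN1r. Qed.

Lemma bform_mulmx n k (G : 'M[R]_n) (A : 'M[R]_(k, n)) v w :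
  bform G (v *m A) (w *m A) = bform (A *m G *m A^T) v w.
Proof. by rewrite /bform trmx_mul !mulmxA. Qed.

Lemma bform_addmx n (A B : 'M[R]_n) v w :
  bform (A + B) v w = bform A v w + bform B v w.
Proof. by rewrite /bform mulmxDr mulmxDl mxE. Qed.

Definition sqnorm k (u : 'rV[R]_k) : R := \sum_j u 0 j ^+ 2.

Lemma sqnorm_ge0 k (u : 'rV[R]_k) : 0 <= sqnorm u.
Proof. by apply: sumr_ge0 => j _; exact: sqr_ge0. Qed.

Lemma sqnorm0 k : sqnorm (0 : 'rV[R]_k) = 0.
Proof. by rewrite /sqnorm big1 // => j _; rewrite mxE expr0n. Qed.

Lemma coord_sqr_le_sqnorm k (u : 'rV[R]_k) i : u 0 i ^+ 2 <= sqnorm u.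
Proof.
rewrite /sqnorm (bigD1 i) //= lerDl.
by apply: sumr_ge0 => j _; exact: sqr_ge0.
Qed.

Lemma bform_sub_gram n q (G : 'M[R]_n) (a : R) (O : 'M[R]_(n, q)) v w :
  bform (G - a *: (O *m O^T)) v w =
  bform G v w - a * ((v *m O) *m (w *m O)^T) 0 0.
Proof.
rewrite /bform mulmxBr mulmxBl -scalemxAr -scalemxAl trmx_mul !mulmxA.
have entryB (A B : 'M[R]_1) : (A - a *: B) 0 0 = A 0 0 - a * B 0 0.
  by rewrite !mxE.
exact: entryB.
Qed.

Lemma bform_sub_gram_diag n q (G : 'M[R]_n) (a : R) (O : 'M[R]_(n, q)) v :
  bform (G - a *: (O *m O^T)) v v = bform G v v - a * sqnorm (v *m O).
Proof.
rewrite bform_sub_gram [X in _ * X]mxE.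
by under eq_bigr => j _ do rewrite [X in _ * X]mxE -expr2.
Qed.

Lemma bform_sub_gram_sym n q (G : 'M[R]_n) (a : R) (O : 'M[R]_(n, q)) :
  (forall v w, bform G v w = bform G w v) ->
  forall v w, bform (G - a *: (O *m O^T)) v w = bform (G - a *: (O *m O^T)) w v.
Proof.
move=> symG v w; rewrite !bform_sub_gram symG.
by rewrite -[v *m O in LHS]trmxK -trmx_mul [_^T 0 0]mxE.
Qed.

Lemma bform_sub_gram_transfer n q (G G' : 'M[R]_n) (a : R)
    (O O' : 'M[R]_(n, q)) v w v' w' :
  bform G v w = bform G' v' w' ->
  a = 0 \/ (v *m O = v' *m O' /\ w *m O = w' *m O') ->
  bform (G - a *: (O *m O^T)) v w = bform (G' - a *: (O' *m O'^T)) v' w'.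
Proof.
move=> GE aO; rewrite !bform_sub_gram GE; congr (_ - _).
by case: aO => [->|[-> ->]] //; rewrite !mul0r.
Qed.

(* Ker O, of dimension at least n - q, and the row space of W, on which the
   form is negative definite, together span R^n. *)
Lemma perturbed_form_nondegenerate_index n q (G : 'M[R]_n) (a : R)
    (O : 'M[R]_(n, q)) :
  (forall v w, bform G v w = bform G w v) -> has_index G q -> 0 <= a ->
  (forall v : 'rV_n, v != 0 -> v *m O = 0 -> 0 < bform G v v) ->
  let G' := G - a *: (O *m O^T) in nondegenerate_form G' /\ has_index G' q.
Proof.
move=> symG [[W [freeW negW]] _] a0 posO G'.
have leG v : bform G' v v <= bform G v v.
  by rewrite bform_sub_gram_diag lerBlDr lerDl mulr_ge0 ?sqnorm_ge0.
have negW' v : (v <= W)%MS -> v != 0 -> bform G' v v < 0.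
  by move=> vW v0; apply: le_lt_trans (leG v) _; exact: negW.
have eqO v : v *m O = 0 -> bform G' v v = bform G v v.
  by move=> vO; rewrite bform_sub_gram_diag vO sqnorm0 mulr0 subr0.
have symG' : forall v w, bform G' v w = bform G' w v.
  exact: bform_sub_gram_sym.
(* On Ker O the two forms agree and are positive, so a subspace negative for [G'] meets Ker O only
   in 0 and embeds into R^q. *)
have indep k (X : 'M[R]_(k, n)) : row_free X -> negative_definite_on G' X ->
    row_free (X *m O).
  move=> freeX negX; apply/row_freeP.
  apply/row_freeP; rewrite -kermx_eq0; apply/eqP/row_matrixP => i.
  rewrite row0; set u := row i _.
  have uXO : u *m X *m O = 0.
    by rewrite -mulmxA /u -row_mul mulmx_ker row0.
  apply/eqP; rewrite -(mulmx_free_eq0 _ freeX); apply/negPn/negP => uX.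
  have := negX _ (submxMl u X) uX; rewrite (eqO _ uXO) ltNge.
  by rewrite (ltW (posO _ uX uXO)).
split; last first.
  split; first by exists W.
  by move=> k X fX nX; have := indep _ _ fX nX; rewrite -row_leq_rank => h;
    apply: leq_trans h (rank_leq_col _).
move=> v vG'.
have uWO : W *m O \in unitmx by rewrite -row_free_unit indep.
pose w := v *m O *m invmx (W *m O) *m W; pose u := v - w.
have uO : u *m O = 0.
  by rewrite mulmxBl -[w *m O]mulmxA mulmxKV // subrr.
have wW : (w <= W)%MS by exact: submxMl.
have eqv : v = w + u by rewrite addrC subrK.
(* Testing the radical vector w + u against w - u cancels the mixed terms. The left side is at most
   0 and the right side at least 0, so both vectors vanish. *)
have h : bform G' w w = bform G' u u.
  have h := vG' (w - u).
  rewrite [X in bform _ X _]eqv bformDl !bformDr !bformNr (symG' u w) in h.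
  by lra.
have u0 : u = 0.
  apply/eqP/negPn/negP => u0; have := posO u u0 uO.
  rewrite -eqO // -h; case: (eqVneq w 0) => [-> |w0].
    by rewrite bform0l ltxx.
  by move/(lt_trans (negW' _ wW w0)); rewrite ltxx.
apply/eqP; rewrite eqv u0 addr0; apply/negPn/negP => w0.
by have := negW' _ wW w0; rewrite h u0 bform0l ltxx.
Qed.

(** A crude operator norm: it bounds both v B and the quadratic form of B in terms of the max norm,
    which is the norm of row vectors here. *)
Definition entry_sum m n (B : 'M[R]_(m, n)) : R := \sum_i \sum_j `|B i j|.

Lemma entry_sum_ge0 m n (B : 'M[R]_(m, n)) : 0 <= entry_sum B.
Proof. by apply: sumr_ge0 => i _; apply: sumr_ge0. Qed.

Lemma coord_le_norm m n (B : 'M[R]_(m, n)) i j : `|B i j| <= `|B|.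
Proof.
rewrite [leRHS]/Num.norm /= mx_normrE.
exact: (le_bigmax _ (fun ij => `|B ij.1 ij.2|) (i, j)).
Qed.

Lemma norm_le_coord m n (B : 'M[R]_(m, n)) e : 0 <= e ->
  (forall i j, `|B i j| <= e) -> `|B| <= e.
Proof.
move=> e0 h; rewrite [leLHS]/Num.norm /= mx_normrE.
by apply/bigmax_leP; split=> // -[i j].
Qed.

Lemma norm_delta_mx q (j : 'I_q) : `|delta_mx 0 j : 'rV[R]_q| = 1.
Proof.
apply/eqP; rewrite eq_le; apply/andP; split.
  apply: norm_le_coord => // i k; rewrite mxE.
  by case: (_ && _); rewrite ?normr1 ?normr0.
by have := coord_le_norm (delta_mx 0 j : 'rV[R]_q) 0 j; rewrite mxE !eqxx normr1.
Qed.

Lemma norm_mulmx_le m n k (u : 'M[R]_(m, n)) (B : 'M[R]_(n, k)) :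
  `|u *m B| <= `|u| * entry_sum B.
Proof.
apply: norm_le_coord => [|i j]; first by rewrite mulr_ge0 // entry_sum_ge0.
rewrite mxE (le_trans (ler_norm_sum _ _ _)) // mulr_sumr; apply: ler_sum => l _.
rewrite normrM ler_pM // ?coord_le_norm // (bigD1 j) //= lerDl.
exact: sumr_ge0.
Qed.

Lemma norm_bform_le n (B : 'M[R]_n) v : `|bform B v v| <= entry_sum B * `|v| ^+ 2.
Proof.
rewrite /bform mxE (le_trans (ler_norm_sum _ _ _)) //.
have -> : entry_sum B = \sum_j \sum_i `|B i j| by rewrite /entry_sum exchange_big.
rewrite mulr_suml; apply: ler_sum => j _.
rewrite mxE normrM mulr_suml mxE.
apply: le_trans (_ : (\sum_i `|v 0 i * B i j|) * `|v| <= _).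
  by apply: ler_pM => //; [exact: ler_norm_sum|exact: coord_le_norm].
rewrite mulr_suml; apply: ler_sum => i _.
rewrite normrM expr2 mulrA [`|v 0 i| * _]mulrC.
by rewrite ler_wpM2r // ler_wpM2l // coord_le_norm.
Qed.

Lemma sqr_norm_le_sqnorm k (u : 'rV[R]_k) : `|u| ^+ 2 <= sqnorm u.
Proof.
rewrite -[leRHS]sqr_sqrtr ?sqnorm_ge0 // ler_pXn2r ?nnegrE ?sqrtr_ge0 //.
apply: norm_le_coord => [|i j]; first exact: sqrtr_ge0.
by rewrite (ord1 i) -sqrtr_sqr ler_wsqrtr // coord_sqr_le_sqnorm.
Qed.

Lemma sqnorm_le k (u : 'rV[R]_k) : sqnorm u <= k%:R * `|u| ^+ 2.
Proof.
rewrite /sqnorm -[k in k%:R]card_ord -sum1_card natr_sum mulr_suml.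
apply: ler_sum => j _; rewrite mul1r -real_normK ?num_real //.
by rewrite ler_pXn2r ?nnegrE // coord_le_norm.
Qed.

Lemma cvg_sum (V : normedModType R) (I : finType) (T : Type) (F : set_system T)
    {FF : Filter F} (f : I -> T -> V) (a : I -> V) :
  (forall i, f i x @[x --> F] --> a i) ->
  \sum_i f i x @[x --> F] --> \sum_i a i.
Proof.
move=> h.
by apply: (@cvg_big V I +%R 0 xpredT (@add_continuous V)) => i _; exact: h.
Qed.

(** m is the minimum of the quadratic form on the compact unit sphere; homogeneity gives the
    rest. *)
Lemma posdef_lower_bound n (B : 'M[R]_n) :
  (forall v : 'rV_n, v != 0 -> 0 < bform B v v) ->
  exists2 m, 0 < m & forall v, m * `|v| ^+ 2 <= bform B v v.
Proof.
move=> posB.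
pose Sph : set 'rV[R]_n := [set v | `|v| = 1].
have cptS : compact Sph.
  apply: bounded_closed_compact.
    by exists 1; split=> // r r1 v /= ->; exact: ltW.
  have -> : Sph = (fun v => `|v|) @^-1` [set 1] by [].
  apply: closed_comp; last exact: closed_eq.
  by move=> v _; exact: norm_continuous.
have contB : continuous (fun v : 'rV[R]_n => bform B v v).
  have -> : (fun v : 'rV[R]_n => bform B v v) =
      (fun v => \sum_j (\sum_i v 0 i * B i j) * v 0 j).
    apply/funext => v; rewrite /bform mxE; apply: eq_bigr => j _.
    by rewrite !mxE.
  move=> v; apply: (@cvg_sum _ _ _ (nbhs v)) => j.
  apply: cvgM; last exact: coord_continuous.
  apply: (@cvg_sum _ _ _ (nbhs v)) => i.
  by apply: cvgM; [exact: coord_continuous|exact: cvg_cst].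
case: (pselect (Sph !=set0)) => [S0|S0]; last first.
  (* The sphere is empty only if 0 is the only vector. *)
  exists 1 => // v; have -> : v = 0; last by rewrite normr0 bform0l expr0n mulr0.
  apply/eqP/negPn/negP => v0; apply: S0; exists (`|v|^-1 *: v).
  by rewrite /Sph /= normrZ normfV normr_id mulVf // normr_eq0.
have [v0 Sv0 hv0] := EVT_min_rV S0 cptS (continuous_subspaceT contB).
have {}Sv0 : `|v0| = 1 by move: Sv0; rewrite inE.
have v00 : v0 != 0 by rewrite -normr_gt0 Sv0 ltr01.
exists (bform B v0 v0); first exact: posB.
move=> v; case: (eqVneq v 0) => [->|vn0].
  by rewrite normr0 bform0l expr0n mulr0.
have Sv : `|v|^-1 *: v \in Sph.
  by rewrite inE /Sph /= normrZ normfV normr_id mulVf // normr_eq0.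
have := hv0 _ Sv; rewrite bformZl bformZr mulrA -expr2 mulrC => /ler_wpM2r.
move/(_ (`|v| ^+ 2)); rewrite sqr_ge0 => /(_ isT).
by rewrite -mulrA -exprMn mulVf ?normr_eq0 // expr1n mulr1.
Qed.

(** The columns of L are linear forms whose kernel is P, V is a frame of a complement, E a frame of
    a plane in P, and S gives the coordinates (s, t), dual to E and zero on V. Positivity on P is
    stated as definiteness of G + K L L^T because this is an open condition, so it survives when the
    point and the forms vary. *)
Lemma nondegenerate_form_splitting n q (G : 'M[R]_n) :
  (forall v w, bform G v w = bform G w v) -> nondegenerate_form G ->
  has_index G q -> (1 <= q)%N -> (q <= n - 2)%N ->
  exists (L : 'M[R]_(n, q)) (V : 'M[R]_(q, n)) (E : 'M[R]_(2, n))
         (S : 'M[R]_(n, 2)) (K : R),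
    [/\ V *m L = 1%:M, E *m L = 0, V *m S = 0, E *m S = 1%:M &
        forall v : 'rV_n, v != 0 -> 0 < bform (G + K *: (L *m L^T)) v v].
Proof.
move=> symG nondG [[W [freeW negW]] maxq] q1 qn.
pose N := W *m G *m W^T.
have bN (a : 'rV[R]_q) b : bform N a b = bform G (a *m W) (b *m W).
  by rewrite bform_mulmx.
have negN (a : 'rV[R]_q) : a != 0 -> bform G (a *m W) (a *m W) < 0.
  by move=> a0; apply: negW; rewrite ?submxMl // mulmx_free_eq0.
have uN : N \in unitmx.
  rewrite -row_free_unit -kermx_eq0; apply/eqP/row_matrixP => i.
  rewrite row0; set u := row i _; apply/eqP/negPn/negP => u0.
  have := negN _ u0; rewrite -bN /bform /u -row_mul mulmx_ker row0 mul0mx mxE.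
  by rewrite ltxx.
(* [v *m L] holds the coefficients of the G-orthogonal projection of v to the row space of W, so Ker
   L is the orthogonal complement of W. *)
pose L := G *m W^T *m invmx N.
have WL : W *m L = 1%:M by rewrite /L !mulmxA mulmxV.
have orth v (a : 'rV[R]_q) : v *m L = 0 -> bform G v (a *m W) = 0.
  rewrite /L !mulmxA => /(congr1 (mulmx^~ N)); rewrite mulmxKV // mul0mx => h.
  by rewrite /bform trmx_mul !mulmxA h mul0mx mxE.
(* A negative vector orthogonal to W would enlarge W to a negative definite subspace of dimension q
   + 1. *)
have pos0 v : v *m L = 0 -> 0 <= bform G v v.
  move=> vL; rewrite leNgt; apply/negP => vv.
  have v0 : v != 0 by apply: contraTneq vv => ->; rewrite bform0l ltxx.
  have spl (c : 'rV[R]_(q + 1)) : c *m col_mx W v =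
      lsubmx c *m W + rsubmx c 0 0 *: v.
    rewrite -[c in LHS]hsubmxK mul_row_col; congr (_ + _).
    by rewrite [rsubmx c in LHS]mx11_scalar mul_scalar_mx.
  have frc (c : 'rV[R]_(q + 1)) : c *m col_mx W v = 0 -> c = 0.
    rewrite spl => h; have /(congr1 (mulmx^~ L)) := h.
    rewrite mulmxDl -scalemxAl vL scaler0 addr0 -mulmxA WL mulmx1 mul0mx => l0.
    move: h; rewrite l0 mul0mx add0r => /eqP; rewrite scaler_eq0 (negPf v0) orbF.
    move=> /eqP r0; rewrite -[c]hsubmxK l0 [rsubmx c]mx11_scalar r0.
    by rewrite raddf0 row_mx0.
  have : (q + 1 <= q)%N; last by rewrite addn1 ltnn.
  apply: (maxq _ (col_mx W v)).
    rewrite -kermx_eq0; apply/eqP/row_matrixP => i; rewrite row0.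
    by apply: frc; rewrite -row_mul mulmx_ker row0.
  move=> u /submxP[c ->] c0.
  rewrite spl bformDl !bformDr bformZl bformZr !bformZl !bformZr.
  rewrite (symG (lsubmx c *m W) v) (orth v _ vL) !mulr0 addr0 add0r.
  case: (eqVneq (lsubmx c) 0) => [l0|l0].
    rewrite l0 mul0mx bform0l add0r mulrA -expr2.
    rewrite nmulr_llt0 // lt_neqAle sqr_ge0 andbT eq_sym sqrf_eq0.
    apply: contraNneq c0 => r0; rewrite spl l0 r0.
    by rewrite mul0mx scale0r addr0.
  rewrite mulrA -expr2 -[ltRHS]addr0 ltr_leD ?negN //.
  by rewrite mulr_ge0_le0 // ?sqr_ge0 // ltW.
have posL (v : 'rV_n) : v != 0 -> v *m L = 0 -> 0 < bform G v v.
  move=> v0 vL; rewrite lt_neqAle pos0 // andbT; apply: contraNneq v0 => vv.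
  apply/eqP/nondG => w.
  have [b bL ->] : exists2 b, b *m L = 0 & w = w *m L *m W + b.
    exists (w - w *m L *m W); last by rewrite addrC subrK.
    by rewrite mulmxBl -[_ *m W *m L]mulmxA WL mulmx1 subrr.
  rewrite bformDr (orth v _ vL) add0r; apply/eqP/negPn/negP => vb.
  (* If v is null and not orthogonal to b, this t makes the form equal to -1 at b + t v, against
     [pos0]. Hence v lies in the radical. *)
  pose t := - (bform G b b + 1) / (2 * bform G v b).
  have : 0 <= bform G (b + t *: v) (b + t *: v).
    by apply: pos0; rewrite mulmxDl -scalemxAl bL vL scaler0 addr0.
  rewrite bformDl !bformDr !bformZl !bformZr -vv (symG b v) !mulr0 addr0.
  have : t * (2 * bform G v b) = - (bform G b b + 1) by rewrite divfK ?mulf_neq0.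
  lra.
have rk : (2 <= \rank (kermx L))%N.
  rewrite mxrank_ker; apply: leq_trans (leq_sub2l n (rank_leq_col L)).
  (* The subtraction n - 2 is truncated; q >= 1 forces n >= 3. *)
  by clear -q1 qn; lia.
pose E : 'M[R]_(2, n) := pid_mx 2 *m row_base (kermx L).
have freeE : row_free E.
  rewrite /row_free mxrankMfree ?row_base_free // rank_pid_mx //.
have EL : E *m L = 0.
  by apply/sub_kermxP; apply: submx_trans (submxMl _ _) _; rewrite eq_row_base.
have frX : row_free (col_mx E W).
  rewrite -kermx_eq0; apply/eqP/row_matrixP => i; rewrite row0.
  set c := row i _; have : c *m col_mx E W = 0 by rewrite -row_mul mulmx_ker row0.
  rewrite -[c]hsubmxK mul_row_col => h; have /(congr1 (mulmx^~ L)) := h.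
  rewrite mulmxDl -[_ *m E *m L]mulmxA -[_ *m W *m L]mulmxA EL WL.
  rewrite mulmx0 add0r mulmx1 mul0mx => r0.
  move: h; rewrite r0 mul0mx addr0 => /eqP; rewrite mulmx_free_eq0 // => /eqP ->.
  by rewrite row_mx0.
have [X] := row_freeP frX; rewrite mul_col_mx scalar_mx_block => XE.
have /= := congr1 usubmx XE; rewrite col_mxKu block_mxEh.
rewrite -[row_mx (col_mx _ _) _]block_mxEh block_mxEv col_mxKu => EX.
have /= := congr1 dsubmx XE; rewrite col_mxKd block_mxEv col_mxKd => WX.
(* S consists of the first two columns of a right inverse of the frame (E, W). K exceeds the bound
   [entry_sum N] for the form on W, so it outweighs the negative part. *)
exists L, W, E, (lsubmx X), (entry_sum N + 1); split=> //.
- by rewrite -[X in W *m X]hsubmxK mul_mx_row in WX; have [] := eq_row_mx WX.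
- by rewrite -[X in E *m X]hsubmxK mul_mx_row in EX; have [] := eq_row_mx EX.
move=> v v0; rewrite -[_ *: _]opprK -scaleNr bform_sub_gram_diag mulNr opprK.
set a := v *m L; have [b bL defv] : exists2 b, b *m L = 0 & v = a *m W + b.
  exists (v - a *m W); last by rewrite addrC subrK.
  by rewrite mulmxBl -[_ *m W *m L]mulmxA WL mulmx1 subrr.
have -> : bform G v v = bform N a a + bform G b b.
  by rewrite [in LHS]defv bformDl !bformDr (symG (a *m W) b) (orth b _ bL) bN
    addr0 add0r.
case: (eqVneq a 0) => [a0|a0].
  rewrite a0 bform0l sqnorm0 mulr0 addr0 add0r; apply: posL bL.
  by move: v0; rewrite defv a0 mul0mx add0r.
have := norm_bform_le N a; rewrite ler_norml => /andP[h _].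
have h2 : entry_sum N * `|a| ^+ 2 <= entry_sum N * sqnorm a.
  by rewrite ler_wpM2l ?entry_sum_ge0 // sqr_norm_le_sqnorm.
have h3 : 0 < sqnorm a.
  by apply: lt_le_trans (sqr_norm_le_sqnorm _); rewrite exprn_gt0 // normr_gt0.
have := pos0 _ bL; lra.
Qed.

End BilinearForms.

(** * Induction on the unit interval and contractions *)

HB.instance Definition _ (R : realType) (n : nat) := NormedModule.on 'rV[R]_n.

Section RealLine.
Variable R : realType.

Lemma near_normP (V : normedModType R) (x : V) (P : V -> Prop) :
  (\forall y \near x, P y) <->
  exists2 e, 0 < e & forall y, `|y - x| < e -> P y.
Proof.
rewrite nbhs_normP; split=> -[e e0 Pe]; exists e => // y.
  by move=> xy; apply: Pe; rewrite /ball_ /= distrC.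
by rewrite /ball_ /= distrC; exact: Pe.
Qed.

Lemma near_comp (U V : topologicalType) (h : U -> V) (x : U) (P : V -> Prop) :
  {for x, continuous h} -> (\forall y \near h x, P y) ->
  \forall x' \near x, P (h x').
Proof. by move=> ch hP; exact: ch. Qed.

(** The supremum of the t with P on [0, t) must be 1. The step at t = 0, where its hypothesis is
    void, starts the induction. *)
Lemma real_induction (P : R -> Prop) :
  (forall t, 0 <= t <= 1 -> (forall s, 0 <= s < t -> P s) ->
    exists2 d, 0 < d & forall s, t <= s < t + d -> s <= 1 -> P s) ->
  forall t, 0 <= t <= 1 -> P t.
Proof.
move=> step.
pose S : set R := [set t | 0 <= t <= 1 /\ forall s, 0 <= s < t -> P s].
have S0 : S 0 by split=> [|s /andP[/le_lt_trans h /h]]; rewrite ?ltxx ?lexx ?ler01.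
have supS : has_sup S by split; [exists 0|exists 1 => t [/andP[]]].
pose m := sup S.
have m0 : 0 <= m by apply: (ub_le_sup (proj2 supS)).
have m1 : m <= 1 by apply: ge_sup; [exists 0|move=> t [/andP[]]].
have Pm s : 0 <= s < m -> P s.
  move=> /andP[s0 sm]; have [t [_ tP] st] := sup_gt (ex_intro _ _ S0) sm.
  by apply: tP; rewrite s0.
have [|d d0 Pd] := step m _ Pm; first by rewrite m0.
have m1E : m = 1.
  apply/eqP; rewrite eq_le m1 /= leNgt; apply/negP => mlt.
  pose t := Order.min 1 (m + d / 2).
  have : t <= m.
    apply: (ub_le_sup (proj2 supS)); split.
      by rewrite /t le_min ge_min lexx ler01 /= andbT; lra.
    move=> s /andP[s0]; rewrite lt_min => /andP[s1 sd].
    have [sm|ms] := ltP s m; first by apply: Pm; rewrite s0.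
    apply: Pd; last exact: ltW.
    by rewrite ms /=; lra.
  by rewrite /t ge_min => /orP[]; lra.
move=> t /andP[t0 t1]; have [tm|mt] := ltP t m; first by apply: Pm; rewrite t0.
by apply: Pd => //; rewrite mt /=; lra.
Qed.

(** A mean value inequality without derivatives. At each t the bound is first reached from a point s
    slightly to the left, then carried to the right. *)
Lemma locally_lipschitz_unit_interval (V : normedModType R) (h : R -> V) (k : R) :
  (forall t, 0 <= t <= 1 -> exists2 d, 0 < d &
    forall s, 0 <= s <= 1 -> `|s - t| < d -> `|h s - h t| <= k * `|s - t|) ->
  `|h 1 - h 0| <= k.
Proof.
move=> lip; suff H t : 0 <= t <= 1 -> `|h t - h 0| <= k * t.
  by rewrite -[leRHS]mulr1; apply: H; rewrite ler01 lexx.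
move: t; apply: real_induction => t /andP[t0 t1] IH.
have [|d d0 hd] := lip t; first by rewrite t0.
have Pt : `|h t - h 0| <= k * t.
  have [->|tn0] := eqVneq t 0; first by rewrite subrr normr0 mulr0.
  pose s := Order.max 0 (t - d / 2).
  have tgt0 : 0 < t by rewrite lt_neqAle eq_sym tn0.
  have s0 : 0 <= s by rewrite /s le_max lexx.
  have st : s < t by rewrite /s gt_max tgt0 /=; lra.
  have sd : t - d / 2 <= s by rewrite /s le_max lexx orbT.
  have h1 := IH s; rewrite s0 st in h1; have {}h1 := h1 isT.
  have h2 : `|h s - h t| <= k * (t - s).
    have -> : t - s = `|s - t| by rewrite ler0_norm ?opprB ?subr_le0 // ltW.
    apply: hd; first by rewrite s0; lra.
    by rewrite ltr0_norm ?subr_lt0 //; lra.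
  rewrite (le_trans (ler_distD (h s) _ _)) // distrC (le_trans (lerD h2 h1)) //.
  by rewrite -mulrDr subrK.
exists d => // s /andP[ts std] s1.
have h2 : `|h s - h t| <= k * (s - t).
  have -> : s - t = `|s - t| by rewrite ger0_norm ?subr_ge0.
  apply: hd; first by rewrite s1 (le_trans t0).
  by rewrite ger0_norm ?subr_ge0 //; lra.
rewrite (le_trans (ler_distD (h t) _ _)) // (le_trans (lerD h2 Pt)) //.
by rewrite -mulrDr subrK.
Qed.

Lemma half_contraction_fixpoint (X : completeNormedModType R) (U : set X)
    (F : X -> X) : closed U -> U !=set0 -> (forall y, U y -> U (F y)) ->
  (forall y y', U y -> U y' -> `|F y - F y'| <= 2^-1 * `|y - y'|) ->
  exists2 y, U y & F y = y.
Proof.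
move=> clU U0 FU lipF.
have funF : set_fun U U F by [].
pose phi : {fun U >-> U} := mkfun funF.
have [|y Uy yF] := @banach_fixed_point R X U phi _ clU U0; last by exists y.
have h0 : 0 <= (2^-1 : R) by rewrite invr_ge0.
exists (NngNum h0); split=> /=; first by lra.
by move=> [y y'] [/= Uy Uy']; exact: lipF.
Qed.

End RealLine.

(** * Leaves as graphs over the plane *)

Section Leaves.
Variables (R : realType) (q : nat).
Implicit Types (w : 'rV[R]_2) (y : 'rV[R]_q) (z : 'rV[R]_2 * 'rV[R]_q).

(** [det2 v w] is the value of s dt - t ds at the point v on the vector w. *)
Definition det2 (v w : 'rV[R]_2) : R := v 0 0 * w 0 1 - v 0 1 * w 0 0.

Lemma det2_le v w : `|det2 v w| <= 2 * `|v| * `|w|.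
Proof.
rewrite /det2 (le_trans (ler_normB _ _)) // !normrM.
have h i j : `|v 0 i| * `|w 0 j| <= `|v| * `|w|.
  by rewrite ler_pM // coord_le_norm.
have := h 0 1; have := h 1 0; lra.
Qed.

Lemma det2Zr v w a : det2 v (a *: w) = a * det2 v w.
Proof. by rewrite /det2 !mxE; ring. Qed.

Lemma det2_segment (v w : 'rV[R]_2) t : det2 (v + t *: (w - v)) (w - v) = det2 v w.
Proof. by rewrite /det2 !mxE; ring. Qed.

(* f i gives the transverse coordinates of the i-th foliated chart, of domain
   D i, on a slice R^2 x R^q; A1 and A2 below are its partial differentials. *)
Variables (I : Type) (D : I -> set ('rV[R]_2 * 'rV[R]_q))
  (f : I -> 'rV[R]_2 * 'rV[R]_q -> 'rV[R]_q) (b eps : R) (e : 'rV[R]_q).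

(** The first clause is strict differentiability, with both points free: this is what makes level
    sets Lipschitz graphs. The second says that the tangent plane of a level set lies in a cone of
    opening eps about the kernel of dy + (s dt - t ds) e. *)
Definition submersion_at i z (A1 : 'M[R]_(2, q)) (A2 : 'M[R]_q) : Prop :=
  (forall eta, 0 < eta -> exists2 d, 0 < d & forall z1 z2,
     `|z1 - z| < d -> `|z2 - z| < d ->
     `|f i z1 - f i z2 - ((z1 - z2).1 *m A1 + (z1 - z2).2 *m A2)|
       <= eta * `|z1 - z2|) /\
  (forall w y, w *m A1 + y *m A2 = 0 ->
     `|y + det2 z.1 w *: e| <= eps * `|(w, y)|).

Hypotheses (b_small : b <= 4^-1) (eps_gt0 : 0 < eps) (eps_small : eps <= 8^-1)
  (norm_e : `|e| = 1).
Hypothesis open_D : forall i, open (D i).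
Hypothesis cover_D : forall z, `|z| < b -> exists i, D i z.
Hypothesis trans_f : forall i j z, D i z -> D j z ->
  \forall z' \near z, f i z' = f i z -> f j z' = f j z.
Hypothesis submersion_f : forall i z, `|z| < b -> D i z ->
  exists A1 A2, submersion_at i z A1 A2.

Lemma pair_norm w y : `|(w, y)| = Num.max `|w| `|y|.
Proof. by rewrite prod_normE. Qed.

Lemma norm_fst_le z : `|z.1| <= `|z|.
Proof. by rewrite [leRHS]prod_normE le_max lexx. Qed.

Lemma norm_snd_le z : `|z.2| <= `|z|.
Proof. by rewrite [leRHS]prod_normE le_max lexx orbT. Qed.

(** For a vertical kernel vector the cone condition reads |y| <= eps |y|. So level sets are
    transverse to the vertical directions. *)
Lemma vertical_unit i z A1 A2 : submersion_at i z A1 A2 -> A2 \in unitmx.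
Proof.
move=> [_ kerA]; rewrite -row_free_unit -kermx_eq0.
apply/eqP/row_matrixP => k; rewrite row0; set y := row k _.
have /(kerA 0 y) : 0 *m A1 + y *m A2 = 0.
  by rewrite mul0mx add0r /y -row_mul mulmx_ker row0.
rewrite /det2 !mxE !mulr0 subrr scale0r addr0 pair_norm normr0.
rewrite (max_idPr _) // => h; apply/eqP; rewrite -normr_eq0 eq_le normr_ge0 andbT.
have := eps_small; have := normr_ge0 y; nra.
Qed.

(* A displacement along a level set of f lies within o(|z' - z|) of the kernel
   of the differential of f, where the cone condition holds with eps. *)
Lemma level_set_cone i z : `|z| < b -> D i z ->
  \forall z' \near z, f i z' = f i z ->
    `|z'.2 - z.2 + det2 z.1 (z'.1 - z.1) *: e| <= 2 * eps * `|z' - z|.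
Proof.
move=> zb Dz; have [A1 [A2 subA]] := submersion_f zb Dz.
have uA := vertical_unit subA; have [sd kerA] := subA.
pose B := entry_sum (invmx A2); have B0 : 0 <= B := entry_sum_ge0 _.
pose eta := eps / (2 * (B + 1)).
have eta0 : 0 < eta by rewrite divr_gt0 // mulr_gt0 //; lra.
have Beta : B * eta <= eps / 2.
  have : eta * (2 * (B + 1)) = eps by rewrite divfK // lt0r_neq0 //; lra.
  by lra.
have [d d0 hd] := sd _ eta0.
apply/near_normP; exists d => // z' zz' fz'.
have := hd z' z zz'; rewrite subrr normr0 => /(_ d0).
rewrite fz' subrr sub0r normrN; set rho := (_ + _) => hrho.
(* Removing this error term puts the displacement exactly in the kernel; by the choice of [eta] it
   costs at most eps/2 times the displacement. *)
pose y' := z'.2 - z.2 - rho *m invmx A2.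
have hr : `|rho *m invmx A2| <= eps / 2 * `|z' - z|.
  rewrite (le_trans (norm_mulmx_le _ _)) // -/B.
  have := normr_ge0 (z' - z); nra.
have /(kerA (z'.1 - z.1) y') : (z'.1 - z.1) *m A1 + y' *m A2 = 0.
  by rewrite [y' *m A2]mulmxBl mulmxKV // addrA; exact: subrr.
have hy' : `|(z'.1 - z.1, y')| <= (1 + eps / 2) * `|z' - z|.
  rewrite pair_norm ge_max; apply/andP; split.
    have := norm_fst_le (z' - z); have := normr_ge0 (z' - z).
    have := eps_gt0 => ? ? /= h; nra.
  rewrite (le_trans (ler_normB _ _)) //.
  by have := norm_snd_le (z' - z) => /= h; lra.
move=> hk; have -> : z'.2 - z.2 + det2 z.1 (z'.1 - z.1) *: e =
    (y' + det2 z.1 (z'.1 - z.1) *: e) + rho *m invmx A2.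
  by rewrite /y' [RHS]addrAC subrK.
rewrite (le_trans (ler_normD _ _)) //.
have h1 := ler_wpM2l (ltW eps_gt0) hy'.
have : 0 <= (8^-1 - eps) * (eps * `|z' - z|).
  by rewrite mulr_ge0 ?subr_ge0 // mulr_ge0 // ltW.
have : 0 <= eps * `|z' - z| by rewrite mulr_ge0 // ltW.
by lra.
Qed.

(** The uniqueness half of the implicit function theorem: solving for the vertical difference
    through the inverse of A2 leaves at most half of it on the right. Both points vary, whereas in
    [level_set_cone] one is fixed. *)
Lemma level_set_lipschitz i z0 : `|z0| < b -> D i z0 ->
  exists C r, [/\ 0 <= C, 0 < r & forall z z', `|z - z0| < r -> `|z' - z0| < r ->
    f i z = f i z' -> `|z.2 - z'.2| <= C * `|z.1 - z'.1|].
Proof.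
move=> zb Dz; have [A1 [A2 subA]] := submersion_f zb Dz.
have uA := vertical_unit subA; have [sd _] := subA.
pose B := entry_sum (invmx A2); have B0 : 0 <= B := entry_sum_ge0 _.
pose a := entry_sum A1; have a0 : 0 <= a := entry_sum_ge0 _.
have eta0 : 0 < (2 * (B + 1))^-1 by rewrite invr_gt0; lra.
have Beta : B * (2 * (B + 1))^-1 <= 2^-1.
  have : (2 * (B + 1))^-1 * (2 * (B + 1)) = 1 by rewrite mulVf // lt0r_neq0; lra.
  by lra.
have [d d0 hd] := sd _ eta0.
exists (1 + 2 * B * a), d; split=> //; first by have := mulr_ge0 B0 a0; lra.
move=> z z' zd z'd fE; have := hd z z' zd z'd; rewrite fE subrr sub0r normrN /=.
set x := z.1 - z'.1; set y := z.2 - z'.2; set rho := (_ + _) => hrho.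
have yE : y = (rho - x *m A1) *m invmx A2.
  by rewrite /rho [_ + _ - _]addrC addKr mulmxK.
have : `|y| <= B * `|rho| + B * (`|x| * a).
  rewrite {1}yE (le_trans (norm_mulmx_le _ _)) // -/B mulrC -mulrDr.
  by rewrite ler_wpM2l // (le_trans (ler_normB _ _)) // lerD2l norm_mulmx_le.
have hrho2 : B * `|rho| <= 2^-1 * `|(x, y)|.
  have := normr_ge0 ((x, y) : 'rV[R]_2 * 'rV[R]_q); have : `|z - z'| = `|(x, y)| by [].
  by move=> zz; rewrite zz in hrho; nra.
have : `|(x, y)| <= `|x| + `|y|.
  by rewrite pair_norm ge_max lerDl lerDr !normr_ge0.
by lra.
Qed.

Definition convex_set (W : set 'rV[R]_2) : Prop :=
  forall v w, W v -> W w -> forall t, 0 <= t <= 1 -> W (v + t *: (w - v)).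

Definition disk (c : 'rV[R]_2) (r : R) : set 'rV[R]_2 := [set w | `|w - c| < r].

Lemma convex_disk c r : convex_set (disk c r).
Proof.
move=> v w; rewrite /disk /= => vr wr t /andP[t0 t1].
have -> : v + t *: (w - v) - c = (1 - t) *: (v - c) + t *: (w - c).
  by apply/rowP => k; rewrite !mxE; ring.
rewrite (le_lt_trans (ler_normD _ _)) // !normrZ (ger0_norm t0).
rewrite ger0_norm ?subr_ge0 //.
have [t1'|t1'] := ltP t 1; first by nra.
have -> : t = 1 by lra.
by rewrite subrr mul0r add0r mul1r.
Qed.

Lemma convex_setI V W : convex_set V -> convex_set W -> convex_set (V `&` W).
Proof. by move=> cV cW v w [? ?] [? ?] t t01; split; [apply: cV|apply: cW]. Qed.

Lemma near_disk c r w : disk c r w -> \forall w' \near w, disk c r w'.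
Proof.
rewrite /disk /= => wr; apply/near_normP; exists (r - `|w - c|); first by lra.
by move=> w' ww' /=; rewrite (le_lt_trans (ler_distD w _ _)) //; lra.
Qed.

(** Only continuity of u is required; [level_set_cone] then yields the slope. All charts i are
    included so that any of them can be used at a point. *)
Definition leaf_at (u : 'rV[R]_2 -> 'rV[R]_q) w : Prop :=
  [/\ `|(w, u w)| < b, {for w, continuous u} &
      forall i, D i (w, u w) ->
        \forall w' \near w, f i (w', u w') = f i (w, u w)].

Definition leaf (u : 'rV[R]_2 -> 'rV[R]_q) (W : set 'rV[R]_2) : Prop :=
  forall w, W w -> leaf_at u w.

Lemma leafS u V W : V `<=` W -> leaf u W -> leaf u V.
Proof. by move=> VW lu w /VW /lu. Qed.

Lemma leaf_at_near u v w : leaf_at u w -> (\forall w' \near w, v w' = u w') ->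
  leaf_at v w.
Proof.
move=> [ub cu lu] vu; have vuw : v w = u w := nbhs_singleton vu.
split; rewrite ?vuw //.
  rewrite /prop_for /continuous_at vuw.
  apply: cvg_trans cu; apply: (@near_eq_cvg _ _ (nbhs w) _ u v).
  by apply: filterS vu => w' ->.
by move=> i /lu; apply: filterS2 vu => w' ->.
Qed.

Lemma graph_cvg (u : 'rV[R]_2 -> 'rV[R]_q) w : {for w, continuous u} ->
  (w', u w') @[w' --> w] --> (w, u w).
Proof.
move=> cu.
exact: (@cvg_pair _ _ _ (nbhs w) (nbhs w) (nbhs (u w)) _ _ _ id u (@cvg_id _ _)).
Qed.

Lemma leaf_at_slope u w : leaf_at u w -> \forall w' \near w,
  `|u w' - u w| <= 1 * `|w' - w| /\
  `|u w' - u w + det2 w (w' - w) *: e| <= 2 * eps * `|w' - w|.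
Proof.
move=> [ub cu lu]; have [i Di] := cover_D ub.
have := graph_cvg cu (level_set_cone ub Di); rewrite near_simpl.
apply: filterS2 (lu _ Di) => w' fE /(_ fE) /=.
have -> : `|(w', u w') - (w, u w)| = Num.max `|w' - w| `|u w' - u w|.
  exact: pair_norm.
set x := w' - w; set y := u w' - u w => h.
have hd : `|det2 w x *: e| <= 2^-1 * `|x|.
  rewrite normrZ norm_e mulr1 (le_trans (det2_le _ _)) //.
  have := norm_fst_le (w, u w) => /= h1.
  have := normr_ge0 x; have := b_small; nra.
have hy : `|y| <= `|y + det2 w x *: e| + `|det2 w x *: e|.
  by rewrite -{1}[y](addrK (det2 w x *: e)) ler_normB.
(* If |y| were the larger one, the cone and the bound |x|/2 on the twist would give |y| <= |y|/4 +
   |y|/2. So |x| is the norm of the whole displacement. *)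
have yx : `|y| <= `|x|.
  rewrite leNgt; apply/negP => xy; rewrite (max_idPr (ltW xy)) in h.
  have := normr_ge0 x; have := eps_small; have := eps_gt0; nra.
by rewrite (max_idPl yx) in h; rewrite mul1r.
Qed.

(** Along the segment the twist form takes the constant value [det2 v w], so adding its multiple by
    t to u leaves a curve of speed at most 2 eps |w - v|. *)
Lemma leaf_segment u W v w : convex_set W -> leaf u W -> W v -> W w ->
  `|u w - u v| <= `|w - v| /\ `|u w - u v + det2 v w *: e| <= 2 * eps * `|w - v|.
Proof.
move=> cW lu Wv Ww; pose g (t : R) : 'rV[R]_2 := v + t *: (w - v).
have g0 : g 0 = v by rewrite /g scale0r addr0.
have g1 : g 1 = w by rewrite /g scale1r addrC subrK.
have gB (s t : R) : g s - g t = (s - t) *: (w - v).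
  by rewrite /g opprD addrACA subrr add0r -scalerBl.
have cg (t : R) : {for t, continuous g}.
  by apply: cvgD; [exact: cvg_cst|apply: cvgZr_tmp; exact: cvg_id].
have slope (t : R) : 0 <= t <= 1 -> \forall s \near t,
    `|u (g s) - u (g t)| <= 1 * `|g s - g t| /\
    `|u (g s) - u (g t) + det2 (g t) (g s - g t) *: e| <= 2 * eps * `|g s - g t|.
  by move=> t01; exact: near_comp (cg t) (leaf_at_slope (lu _ (cW _ _ Wv Ww _ t01))).
split.
  have := @locally_lipschitz_unit_interval R _ (u \o g) `|w - v|.
  rewrite /= g0 g1; apply => t /slope/near_normP[d d0 hd]; exists d => // s _ /hd[].
  by rewrite gB normrZ mul1r mulrC.
have := @locally_lipschitz_unit_interval R _
  (fun t => u (g t) + (t * det2 v w) *: e) (2 * eps * `|w - v|).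
rewrite g0 g1 mul0r scale0r addr0 mul1r addrAC; apply.
move=> t /slope/near_normP[d d0 hd]; exists d => // s _ /hd[_].
rewrite gB det2Zr det2_segment normrZ => h.
rewrite opprD addrACA -scalerBl -mulrBl (le_trans h) //.
by rewrite mulrCA mulrC.
Qed.

Lemma leaf_unique u v W w0 w : convex_set W -> leaf u W -> leaf v W ->
  W w0 -> u w0 = v w0 -> W w -> u w = v w.
Proof.
move=> cW lu lv Ww0 uv0 Ww; pose g (t : R) : 'rV[R]_2 := w0 + t *: (w - w0).
have g0 : g 0 = w0 by rewrite /g scale0r addr0.
have g1 : g 1 = w by rewrite /g scale1r addrC subrK.
have cg (t : R) : {for t, continuous g}.
  by apply: cvgD; [exact: cvg_cst|apply: cvgZr_tmp; exact: cvg_id].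
suff agree (t : R) : 0 <= t <= 1 -> u (g t) = v (g t).
  by rewrite -g1; apply: agree; rewrite ler01 lexx.
move: t; apply: (@real_induction R (fun t => u (g t) = v (g t))) => t t01 IH.
have Wg : W (g t) by exact: cW.
have [ub cu lcu] := lu _ Wg; have [vb cv lcv] := lv _ Wg.
(* Agreement passes to the limit from the left by continuity. *)
have uvt : u (g t) = v (g t).
  have [->|tn0] := eqVneq t 0; first by rewrite g0.
  apply/eqP; rewrite -subr_eq0 -normr_le0 leNgt; apply/negP => duv.
  have e0 : 0 < `|u (g t) - v (g t)| / 2 by rewrite divr_gt0.
  have /cvgrPdistC_lt/(_ _ e0)/(near_comp (cg t)) := cu.
  have /cvgrPdistC_lt/(_ _ e0)/(near_comp (cg t)) := cv.
  move=> /near_normP[d1 d10 h1] /near_normP[d2 d20 h2].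
  pose d := Order.min d1 d2; have d0 : 0 < d by rewrite lt_min d10.
  pose s := Order.max 0 (t - d / 2).
  have tgt0 : 0 < t by rewrite lt_neqAle eq_sym tn0; case/andP: t01.
  have s0 : 0 <= s by rewrite /s le_max lexx.
  have st : s < t by rewrite /s gt_max tgt0 /=; lra.
  have sd : t - d / 2 <= s by rewrite /s le_max lexx orbT.
  have std : `|s - t| < d by rewrite ltr0_norm ?subr_lt0 //; lra.
  move: std; rewrite lt_min => /andP[/h1 {}h1 /h2 {}h2].
  have uvs := IH s; rewrite s0 st in uvs; rewrite uvs // in h2.
  have := ler_distD (v (g s)) (u (g t)) (v (g t)).
  by rewrite (distrC (u (g t)) (v (g s))); lra.
have [i Di] := cover_D ub.
have [C [r [C0 r0 inj]]] := level_set_lipschitz ub Di.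
have Di' := Di; rewrite uvt in Di'.
have near_z : \forall z \near (g t, u (g t)), `|z - (g t, u (g t))| < r.
  by apply/near_normP; exists r.
have nv : \forall w' \near g t, `|(w', v w') - (g t, u (g t))| < r.
  by have := graph_cvg cv; rewrite -uvt => /(_ _ near_z).
(* Agreement is open: both graph points lie on one level set over the same w', so the Lipschitz
   bound gives distance 0. *)
have nE : \forall w' \near g t, u w' = v w'.
  near=> w'; apply/eqP; rewrite -subr_eq0 -normr_le0.
  have := inj (w', u w') (w', v w'); rewrite /= subrr normr0 mulr0; apply.
  - near: w'; exact: (graph_cvg cu near_z).
  - by near: w'.
  - transitivity (f i (g t, u (g t))); first by near: w'; exact: lcu.
    by rewrite uvt; apply/esym; near: w'; exact: lcv.
have /near_normP[d d0 hd] := near_comp (cg t) nE; exists d => // s /andP[ts std] _.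
by apply: hd; rewrite ger0_norm ?subr_ge0 //; lra.
Unshelve. all: by end_near. Qed.

(** The existence half of the implicit function theorem, with one radius d serving all z near z0. *)
Lemma local_leaf z0 : `|z0| < b -> exists2 d, 0 < d &
  forall z, `|z - z0| < d -> exists u, leaf u (disk z.1 d) /\ u z.1 = z.2.
Proof.
move=> zb; have [i Dz] := cover_D zb.
have [A1 [A2 subA]] := submersion_f zb Dz.
have uA := vertical_unit subA; have [sd _] := subA.
have [C [r1 [C0 r10 inj]]] := level_set_lipschitz zb Dz.
pose B := entry_sum (invmx A2); have B0 : 0 <= B := entry_sum_ge0 _.
have eta0 : 0 < (2 * (B + 1))^-1 by rewrite invr_gt0; lra.
have Beta : B * (2 * (B + 1))^-1 <= 2^-1.
  have : (2 * (B + 1))^-1 * (2 * (B + 1)) = 1 by rewrite mulVf // lt0r_neq0; lra.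
  by lra.
move: eta0 Beta; set eta := _^-1 => eta0 Beta.
have [r2 r20 hsd] := sd _ eta0.
have /near_normP[r3 r30 Dr3] : \forall z \near z0, D i z.
  by apply: open_nbhs_nbhs; split => //; exact: open_D.
pose r4 := b - `|z0|; have r40 : 0 < r4 by rewrite subr_gt0.
pose r := Num.min (Num.min r1 r2) (Num.min r3 r4) / 2.
have r0 : 0 < r by rewrite divr_gt0 // !lt_min r10 r20 r30.
have [rr1 rr2 rr3 rr4] : [/\ r < r1, r < r2, r < r3 & r < r4].
  have : r < Num.min (Num.min r1 r2) (Num.min r3 r4).
    by rewrite /r gtr_pMr ?invf_lt1 ?ltr1n // !lt_min r10 r20 r30.
  by rewrite !lt_min => /andP[/andP[-> ->] /andP[-> ->]].
pose M := entry_sum A1 + entry_sum A2 + eta.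
have M0 : 0 <= M by rewrite !addr_ge0 ?entry_sum_ge0 // ltW.
have lipf z z' : `|z - z0| < r2 -> `|z' - z0| < r2 ->
    `|f i z - f i z'| <= M * `|z - z'|.
  move=> zr zr'; have h := hsd _ _ zr zr'.
  have h1 := norm_mulmx_le (z - z').1 A1; have h2 := norm_mulmx_le (z - z').2 A2.
  have h3 := ler_wpM2r (entry_sum_ge0 A1) (norm_fst_le (z - z')).
  have h4 := ler_wpM2r (entry_sum_ge0 A2) (norm_snd_le (z - z')).
  have h5 := ler_normD ((z - z').1 *m A1) ((z - z').2 *m A2).
  have h6 := ler_distD ((z - z').1 *m A1 + (z - z').2 *m A2) (f i z - f i z') 0.
  by rewrite !subr0 in h6; rewrite /M; lra.
(* The first bound keeps the points over the disk within r of z0; the second makes the iteration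
   below move its starting point by at most r/2, so that it preserves the ball of radius r. *)
pose d := Num.min (r / 2) (r / (2 * (B * M + 1))).
have BM0 : 0 <= B * M by exact: mulr_ge0.
have d0 : 0 < d by rewrite lt_min (divr_gt0 r0) // (divr_gt0 r0) //; lra.
have dr : d <= r / 2 by rewrite /d ge_min lexx.
have dBM : B * M * d <= r / 2.
  have h : d <= r / (2 * (B * M + 1)) by rewrite /d ge_min lexx orbT.
  rewrite ler_pdivlMr in h; last by lra.
  by lra.
exists d => // z1 z1d; pose k := f i z1.
have z1r : `|z1 - z0| < r by lra.
have w1d : `|z1.1 - z0.1| < d := le_lt_trans (norm_fst_le (z1 - z0)) z1d.
have y1d : `|z1.2 - z0.2| < d := le_lt_trans (norm_snd_le (z1 - z0)) z1d.
have inr w y : disk z1.1 d w -> `|y - z0.2| <= r -> `|(w, y) - z0| <= r.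
  rewrite /disk /= => wd yr; have -> : (w, y) - z0 = (w - z0.1, y - z0.2) by [].
  rewrite pair_norm ge_max yr andbT.
  by have := ler_distD z1.1 w z0.1; lra.
have sol w : exists y, disk z1.1 d w -> `|y - z0.2| <= r /\ f i (w, y) = k.
  case: (pselect (disk z1.1 d w)) => [wd|nwd]; last by exists 0.
  (* Newton iteration with the derivative frozen at z0; its fixed points solve f i (w, y) = k. *)
  pose F y := y - (f i (w, y) - k) *m invmx A2.
  have lipF y y' : `|y - z0.2| <= r -> `|y' - z0.2| <= r ->
      `|F y - F y'| <= 2^-1 * `|y - y'|.
    move=> yr y'r; have h : `|f i (w, y) - f i (w, y') - (y - y') *m A2| <=
        eta * `|y - y'|.
      have := hsd (w, y) (w, y') (le_lt_trans (inr _ _ wd yr) rr2)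
        (le_lt_trans (inr _ _ wd y'r) rr2).
      have -> : (w, y) - (w, y') = (0, y - y') by rewrite -(subrr w).
      by rewrite mul0mx add0r pair_norm normr0 (max_idPr _).
    have -> : F y - F y' =
        - ((f i (w, y) - f i (w, y') - (y - y') *m A2) *m invmx A2).
      rewrite /F [in RHS]mulmxBl mulmxK // !mulmxBl.
      move: (_ *m _) (_ *m _) (_ *m _) => u1 u2 u3.
      by apply/rowP => j; rewrite !mxE; ring.
    rewrite normrN (le_trans (norm_mulmx_le _ _)) // -/B.
    have := ler_wpM2l B0 h; have := ler_wpM2r (normr_ge0 (y - y')) Beta.
    by lra.
  pose U : set 'rV[R]_q := [set y | `|y - z0.2| <= r].
  have Uz0 : U z0.2 by rewrite /U /= subrr normr0 ltW.
  have clU : closed U.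
    have -> : U = closed_ball z0.2 r; last exact: closed_ball_closed.
    by rewrite closed_ballE //; apply/seteqP; split=> y;
      rewrite /U /closed_ball_ /= distrC.
  have FU y : U y -> U (F y).
    move=> Uy; rewrite /U /=; have h1 := lipF _ _ Uy Uz0.
    have h2 : `|F z0.2 - z0.2| <= B * (M * d).
      rewrite /F addrAC subrr sub0r normrN (le_trans (norm_mulmx_le _ _)) //.
      rewrite mulrC ler_wpM2l // (le_trans (lipf _ _ _ _)) //.
      - by rewrite (le_lt_trans (inr _ _ wd _) rr2).
      - exact: lt_trans rr2.
      rewrite ler_wpM2l //; have -> : (w, z0.2) - z1 = (w - z1.1, z0.2 - z1.2) by [].
      by rewrite pair_norm ge_max (distrC z0.2) (ltW y1d) andbT ltW.
    have h3 := ler_distD (F z0.2) (F y) z0.2.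
    have h4 : `|y - z0.2| <= r := Uy.
    by lra.
  have [y Uy Fy] := @half_contraction_fixpoint R 'rV[R]_q U F clU
    (ex_intro _ _ Uz0) FU lipF.
  exists y => _; split=> //; move: Fy; rewrite /F => /eqP.
  rewrite -subr_eq0 addrAC subrr sub0r oppr_eq0 => /eqP.
  move=> /(congr1 (mulmx^~ A2)); rewrite mulmxKV // mul0mx => /eqP.
  by rewrite subr_eq0 => /eqP.
have [u hu] := choice sol; exists u.
have uLip w w' : disk z1.1 d w -> disk z1.1 d w' -> `|u w - u w'| <= C * `|w - w'|.
  move=> wd w'd; have [yr ky] := hu _ wd; have [y'r ky'] := hu _ w'd.
  apply: (inj (w, u w) (w', u w')); last by rewrite ky ky'.
  - exact: le_lt_trans (inr _ _ wd yr) rr1.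
  - exact: le_lt_trans (inr _ _ w'd y'r) rr1.
have disk1 : disk z1.1 d z1.1 by rewrite /disk /= subrr normr0.
split; last first.
  have [yr ky] := hu _ disk1.
  have := inj (z1.1, u z1.1) z1; rewrite subrr normr0 mulr0 normr_le0 subr_eq0.
  move=> h; apply/eqP; apply: h; last by rewrite ky.
    exact: le_lt_trans (inr _ _ disk1 yr) rr1.
  exact: lt_trans rr1.
move=> w wd; have [yr ky] := hu _ wd; have zr := inr _ _ wd yr.
have cu : {for w, continuous u}.
  apply/(@cvgrPdistC_lt _ _ _ (nbhs w)) => e' e'0.
  have : \forall w' \near w, `|w' - w| < e' / (C + 1).
    by apply/near_normP; exists (e' / (C + 1)); rewrite ?divr_gt0 //; lra.
  apply: filterS2 (near_disk wd) => w' w'd h.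
  rewrite (le_lt_trans (uLip _ _ w'd wd)) //.
  rewrite ltr_pdivlMr in h; last by lra.
  by have := normr_ge0 (w' - w); lra.
split=> //.
  have := ler_normD ((w, u w) - z0) z0; rewrite subrK.
  by move: rr4; rewrite /r4; lra.
move=> j Dj; have Di : D i (w, u w) by apply: Dr3; exact: le_lt_trans rr3.
apply: filterS2 (near_comp (graph_cvg cu) (trans_f Di Dj)) (near_disk wd).
by move=> w' h w'd; apply: h; have [_ ->] := hu _ w'd; rewrite ky.
Qed.

Lemma uniform_leaf c : c < b -> exists2 d, 0 < d &
  forall z, `|z| <= c -> exists u, leaf u (disk z.1 d) /\ u z.1 = z.2.
Proof.
move=> cb; pose K : set ('rV[R]_2 * 'rV[R]_q) := [set z | `|z| <= c].
have cptB m : compact [set w : 'rV[R]_m | `|w| <= c].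
  apply: bounded_closed_compact.
    exists c; split=> [|x cx w /= wc]; first exact: num_real.
    by rewrite (le_trans wc) // ltW.
  apply: (@closed_comp _ _ (fun v : 'rV[R]_m => `|v|) [set x | x <= c]).
    by move=> v _; exact: norm_continuous.
  exact: closed_le.
have cptK : compact K.
  have -> : K = [set w | `|w| <= c] `*` [set y | `|y| <= c].
    by apply/seteqP; split=> -[w y]; rewrite /K /= pair_norm ge_max => /andP.
  by apply: compact_setX.
pose P (d : R) (z : 'rV[R]_2 * 'rV[R]_q) :=
  exists u, leaf u (disk z.1 d) /\ u z.1 = z.2.
have [d [Pd d0]] : exists d, K `<=` P d /\ 0 < d.
  have cov : \forall d \near 0^'+, K `<=` P d.
    apply: (proj1 (compact_near_coveringP K) cptK R (0^'+) P).
    move=> z0 Kz0; have [d0 d00 hd] := local_leaf (le_lt_trans Kz0 cb).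
    exists ([set z | `|z - z0| < d0], [set d | d < d0]); last first.
      move=> [z d] [/= /hd[u [lu uz]] dd0]; exists u; split=> //.
      by apply: leafS lu => w; rewrite /disk /= => /lt_trans; apply.
    have near_z0 : \forall z \near z0, `|z - z0| < d0 by apply/near_normP; exists d0.
    by split; [exact: near_z0|exact: nbhs_right_lt].
  near (0 : R)^'+ => d; exists d; split; last by near: d; exact: nbhs_right_gt.
  by near: d; exact: cov.
by exists d.
Unshelve. all: by end_near. Qed.

(* Above w take the local leaf through the point of the graph of u above lam w,
   where lam = r / r'. *)
Lemma extend_leaf c d u r r' : c < b -> 0 < d ->
  (forall z, `|z| <= c -> exists u, leaf u (disk z.1 d) /\ u z.1 = z.2) ->
  0 < r -> r < r' -> r' <= c -> r' <= r + d / 2 ->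
  leaf u (disk 0 r) -> u 0 = 0 ->
  exists v, leaf v (disk 0 r') /\ v 0 = 0.
Proof.
move=> cb d0 loc r0 rr' r'c r'd lu u0.
have disk0 s (w : 'rV[R]_2) : disk 0 s w = (`|w| < s) :> Prop.
  by rewrite /disk /= subr0.
have ub w : `|w| < r -> `|u w| <= `|w|.
  move=> wr; have dw : disk 0 r w by rewrite disk0.
  have d0r : disk 0 r 0 by rewrite disk0 normr0.
  by have [h _] := leaf_segment (@convex_disk _ _) lu d0r dw; rewrite u0 !subr0 in h.
have sol p : exists L, `|p| < r -> leaf L (disk p d) /\ L p = u p.
  have [pr|] := ltP `|p| r; last by exists u.
  have [|L hL] := loc (p, u p); last by exists L.
  by rewrite pair_norm ge_max (le_trans (ub _ pr)) ?andbT // ltW //; lra.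
have [L hL] := choice sol; pose lam := r / r'.
have lam0 : 0 < lam by rewrite divr_gt0 //; lra.
have lamr' : lam * r' = r by rewrite divfK // lt0r_neq0 //; lra.
have lam1 : lam < 1 by rewrite ltr_pdivrMr ?mul1r //; lra.
have lamr w : `|w| < r' -> `|lam *: w| < r.
  by move=> wr'; rewrite normrZ gtr0_norm // -lamr' ltr_pM2l.
(* Shrinking by lam moves w by less than r' - r <= d/2; the other half of d leaves room for a
   neighbourhood. *)
have lamd w : `|w| < r' -> `|w - lam *: w| < d / 2.
  move=> wr'; rewrite -{1}[w]scale1r -scalerBl normrZ gtr0_norm ?subr_gt0 //.
  have := ltr_pM2l (x := 1 - lam); rewrite subr_gt0 => /(_ lam1 `|w| r').
  by rewrite wr'; lra.
exists (fun w => L (lam *: w) w); split; last first.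
  by rewrite scaler0; have [|_ ->] := hL 0; rewrite ?normr0.
move=> w0; rewrite disk0 => w0r'; have [lL Lp] := hL _ (lamr _ w0r').
(* Near w0 the new function coincides with the single local leaf based at lam w0: that leaf agrees
   with u at lam w, hence with the local leaf based there, by uniqueness on intersections of
   disks. *)
apply: (@leaf_at_near (L (lam *: w0))).
  by apply: lL; rewrite /disk /=; have := lamd _ w0r'; lra.
have near_w0 : \forall w \near w0, `|w - w0| < d / 4.
  by apply/near_normP; exists (d / 4) => //; lra.
have /near_disk : disk 0 r' w0 by rewrite disk0.
apply: filterS2 near_w0 => w ww0; rewrite disk0 => wr'.
have pp0 : `|lam *: w - lam *: w0| < d.
  rewrite -scalerBr normrZ gtr0_norm //.
  by have := normr_ge0 (w - w0); nra.
have wp0 : `|w - lam *: w0| < d.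
  by have := lamd _ w0r'; have := ler_distD w0 w (lam *: w0); lra.
have [lLw Lpw] := hL _ (lamr _ wr').
have agree : L (lam *: w0) (lam *: w) = u (lam *: w).
  apply: (@leaf_unique _ _ (disk (lam *: w0) d `&` disk 0 r) (lam *: w0)) => //.
  - by apply: convex_setI; exact: convex_disk.
  - by apply: leafS lL; exact: subIsetl.
  - by apply: leafS lu; exact: subIsetr.
  - by split; rewrite ?disk0 ?lamr // /disk /= subrr normr0.
  - by split; rewrite ?disk0 ?lamr.
apply: (@leaf_unique _ _ (disk (lam *: w) d `&` disk (lam *: w0) d) (lam *: w)).
- by apply: convex_setI; exact: convex_disk.
- by apply: leafS lLw; exact: subIsetl.
- by apply: leafS lL; exact: subIsetr.
- by split=> //; rewrite /disk /= subrr normr0.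
- by rewrite Lpw agree.
- by split=> //; rewrite /disk /=; have := lamd _ wr'; lra.
Qed.

Lemma large_leaf c : 0 < c -> c < b -> exists u, leaf u (disk 0 c) /\ u 0 = 0.
Proof.
move=> c0 cb; have [d d0 loc] := uniform_leaf cb.
have [u0 [lu0 u00]] : exists u, leaf u (disk 0 d) /\ u 0 = 0.
  by have := loc (0, 0); rewrite pair_norm !normr0 (max_idPl _) //; apply; exact: ltW.
(* The radius grows by d/2 until it is capped at c. *)
have main k : exists u, leaf u (disk 0 (Num.min c (d / 2 * k.+1%:R))) /\ u 0 = 0.
  elim: k => [|k [u [lu u0E]]].
    exists u0; split=> //; apply: leafS lu0 => w; rewrite /disk /= mulr1 lt_min.
    by move=> /andP[_]; lra.
  set r := Num.min _ _ in lu; set r' := Num.min _ _.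
  have r0 : 0 < r by rewrite lt_min c0 mulr_gt0 ?ltr0n //; lra.
  have kE : d / 2 * k.+2%:R = d / 2 * k.+1%:R + d / 2.
    by rewrite -[k.+2]addn1 natrD mulrDr mulr1.
  have rr' : r <= r'.
    by rewrite le_min ge_min lexx /= ge_min kE lerDl; apply/orP; right; lra.
  have r'c : r' <= c by rewrite ge_min lexx.
  have r'd : r' <= r + d / 2.
    rewrite /r' /r kE ge_min; have [h|h] := leP c (d / 2 * k.+1%:R).
      by apply/orP; left; lra.
    by apply/orP; right; lra.
  have [rE|rn] := eqVneq r r'; first by rewrite -rE; exists u.
  by apply: (extend_leaf cb d0 loc r0 _ r'c r'd lu u0E); rewrite lt_neqAle rn.
have [k ck] : exists k, c <= d / 2 * k.+1%:R.
  exists (Num.truncn (c / (d / 2))); rewrite mulrC -ler_pdivrMr; last by lra.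
  by rewrite ltW // truncnS_gt.
by have := main k; rewrite (min_idPl ck).
Qed.

Theorem twisted_level_sets : 0 < b -> eps < b / 24 -> False.
Proof.
move=> b0 epsb; have cb : b / 2 < b by lra.
have [|u [lu u0]] := large_leaf _ cb; first by lra.
(* The triangle has edges of max norm at most a and lies in the disk of radius b/2. The twist
   vanishes on its two edges at 0 and is a^2 on the third. *)
pose a := b / 4; have a0 : 0 < a by rewrite /a; lra.
pose v1 : 'rV[R]_2 := delta_mx 0 0; pose v2 : 'rV[R]_2 := delta_mx 0 1.
have norm_le (x y : R) : `|x| <= a -> `|y| <= a -> `|x *: v1 + y *: v2| <= a.
  move=> xa ya; apply: norm_le_coord => [|i j]; first exact: ltW.
  rewrite (ord1 i) !mxE /=; case: j => -[|[|]] //= lt_j.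
    by rewrite mulr1 mulr0 addr0.
  by rewrite mulr0 mulr1 add0r.
have aa : `|a| <= a by rewrite gtr0_norm.
have n0a : `|0 : R| <= a by rewrite normr0 ltW.
pose p1 := a *: v1; pose p2 := a *: v2.
have np1 : `|p1| <= a by have := norm_le a 0 aa n0a; rewrite scale0r addr0.
have np2 : `|p2| <= a by have := norm_le 0 a n0a aa; rewrite scale0r add0r.
have np12 : `|p2 - p1| <= a.
  by have := norm_le (- a) a; rewrite normrN scaleNr addrC; apply.
have D0 : disk 0 (b / 2) 0 by rewrite /disk /= subrr normr0; lra.
have D1 : disk 0 (b / 2) p1 by rewrite /disk /= subr0; rewrite /a in np1; lra.
have D2 : disk 0 (b / 2) p2 by rewrite /disk /= subr0; rewrite /a in np2; lra.
have [_ h1] := leaf_segment (@convex_disk _ _) lu D0 D1.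
have [_ h2] := leaf_segment (@convex_disk _ _) lu D0 D2.
have [_ h3] := leaf_segment (@convex_disk _ _) lu D1 D2.
have d0 w : det2 0 w = 0 by rewrite /det2 !mxE; ring.
have d12 : det2 p1 p2 = a ^+ 2 by rewrite /det2 !mxE /=; ring.
rewrite d0 scale0r addr0 u0 subr0 in h1.
rewrite d0 scale0r addr0 u0 subr0 in h2.
rewrite d12 in h3.
have h : a ^+ 2 <= `|u p2 - u p1 + a ^+ 2 *: e| + `|u p2| + `|u p1|.
  rewrite -addrA; have := ler_normB (u p2) (u p1).
  have := ler_normB (u p2 - u p1 + a ^+ 2 *: e) (u p2 - u p1).
  rewrite addrAC subrr add0r normrZ norm_e mulr1 ger0_norm ?sqr_ge0 //; lra.
rewrite subr0 in h1; rewrite subr0 in h2.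
have e0 := eps_gt0.
have k1 := ler_wpM2l (ltW e0) np1; have k2 := ler_wpM2l (ltW e0) np2.
have k3 := ler_wpM2l (ltW e0) np12.
(* Three edges, each with error at most 2 eps a; but eps < b/24 = a/6. *)
have : a * a <= 6 * eps * a by rewrite -expr2; lra.
by rewrite ler_pM2r // /a; lra.
Qed.

End Leaves.

(** * Smooth functions *)

Section Differentiability.
Variable R : realType.

Lemma near_eps_differentiable (V W : normedModType R) (f : V -> W)
    (df : {linear V -> W}) x : continuous df ->
  (forall eps, 0 < eps ->
    \forall y \near x, `|f y - f x - df (y - x)| <= eps * `|y - x|) ->
  differentiable f x /\ 'd f x = df :> (V -> W).
Proof.
move=> cdf h.
have dE : f \o shift x = cst (f x) + df +o_ 0 id.
  apply/eqaddoP => eps eps0; have /near_normP[d d0 hd] := h _ eps0.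
  rewrite nearE; apply/near_normP; exists d => // y; rewrite subr0 => yd /=.
  by have := hd (y + x); rewrite addrK opprD addrA => /(_ yd).
have dfE := diff_unique cdf dE; split=> //.
by apply/diff_locallyP; rewrite dfE.
Qed.

Lemma differentiable_near_eps (V W : normedModType R) (f : V -> W) x eps :
  differentiable f x -> 0 < eps ->
  \forall y \near x, `|f y - f x - 'd f x (y - x)| <= eps * `|y - x|.
Proof.
move=> /diff_locallyP[_ /eqaddoP dE] eps0; have := dE _ eps0.
rewrite nearE => /near_normP[d d0 hd]; apply/near_normP; exists d => // y yd.
by have := hd (y - x); rewrite subr0 => /(_ yd) /=;
  rewrite !fctE /= subrK opprD addrA.
Qed.

Lemma near_eq_differentiable (V W : normedModType R) (f g : V -> W) x :
  (\forall y \near x, f y = g y) -> differentiable f x ->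
  differentiable g x /\ 'd g x = 'd f x :> (V -> W).
Proof.
move=> fg df; apply: near_eps_differentiable; first exact: diff_continuous.
move=> eps eps0; have := differentiable_near_eps df eps0.
by rewrite (nbhs_singleton fg); apply: filterS2 fg => y ->.
Qed.

Lemma derive_linear (V W W' : normedModType R) (l : {linear W -> W'})
    (f : V -> W) x : continuous l -> differentiable f x ->
  differentiable (l \o f) x /\ forall v, 'D_v (l \o f) x = l ('D_v f x).
Proof.
move=> cl df; have dl := linear_differentiable (f x) cl.
have dlf := differentiable_comp df dl; split=> // v.
by rewrite !deriveE // diff_comp //= diff_lin.
Qed.

(** Order 0 means differentiable, not merely continuous. The finite order is what the product and
    chain rules need for an induction, since a derivative of a product involves the undifferentiated
    factors too. *)
Fixpoint class_C (V W : normedModType R) k (U : set V) (f : V -> W) : Prop :=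
  (forall x, U x -> differentiable f x) /\
  if k is k'.+1 then forall v, class_C k' U ('D_v f) else True.

Lemma smooth_onP (V W : normedModType R) (U : set V) (f : V -> W) :
  smooth_on U f <-> forall k, class_C k U f.
Proof.
split=> [sf k|].
  elim: k f sf => [|k IH] f sf; (split; first exact: (sf [::])) => // v.
  by apply: IH => vs x Ux; have := sf (rcons vs v) x Ux; rewrite foldr_rcons.
move=> Cf vs; elim/last_ind: vs f Cf => [|vs v IH] f Cf x Ux.
  by have [/= df _] := Cf 0%N; exact: df.
rewrite foldr_rcons; apply: IH Ux => k; have [_ df] := Cf k.+1; exact: df.
Qed.

Lemma class_CW (V W : normedModType R) k (U : set V) (f : V -> W) :
  class_C k.+1 U f -> class_C k U f.
Proof.
elim: k f => [|k IH] f [df Df]; split=> // v.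
by apply: IH; exact: Df.
Qed.

Lemma class_C_eq (V W : normedModType R) k (U : set V) (f g : V -> W) :
  open U -> (forall x, U x -> f x = g x) -> class_C k U f -> class_C k U g.
Proof.
move=> oU; elim: k f g => [|k IH] f g fg [df Df].
  split=> // x Ux; have [] // := @near_eq_differentiable _ _ f g x _ (df x Ux).
  by apply: filterS (open_nbhs_nbhs (conj oU Ux)).
have nfg x : U x -> \forall y \near x, f y = g y.
  by move=> Ux; apply: filterS (open_nbhs_nbhs (conj oU Ux)).
split=> [x Ux|v]; first by have [] := near_eq_differentiable (nfg _ Ux) (df x Ux).
by apply: IH (Df v) => x Ux; apply: near_eq_derive; exact: nfg.
Qed.

Lemma class_C_cst (V W : normedModType R) k (U : set V) (a : W) :
  class_C k U (fun _ : V => a).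
Proof.
elim: k a => [|k IH] a.
  by split=> // x _; exact: differentiable_cst.
split=> [x _|v]; first exact: differentiable_cst.
have -> : 'D_v (fun _ : V => a) = (fun _ => 0) by apply/funext => x; exact: derive_cst.
exact: IH.
Qed.

Lemma class_C_real (V : normedModType R) k (U : set V) (a : R) :
  class_C k U (fun _ => a).
Proof. exact: class_C_cst. Qed.

Lemma class_CD (V W : normedModType R) k (U : set V) (f g : V -> W) :
  open U -> class_C k U f -> class_C k U g -> class_C k U (fun x => f x + g x).
Proof.
move=> oU; elim: k f g => [|k IH] f g [df Df] [dg Dg].
  by split=> // x Ux; exact: differentiableD (df x Ux) (dg x Ux).
split=> [x Ux|v]; first by exact: differentiableD (df x Ux) (dg x Ux).
apply: class_C_eq (IH _ _ (Df v) (Dg v)) => // x Ux.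
apply/esym; exact: deriveD (diff_derivable (df x Ux)) (diff_derivable (dg x Ux)).
Qed.

Lemma class_C_sum (V W : normedModType R) k (U : set V) (I : finType)
    (f : I -> V -> W) : open U -> (forall i, class_C k U (f i)) ->
  class_C k U (fun x => \sum_i f i x).
Proof.
move=> oU Cf; elim: (index_enum I) => [|i s IH].
  apply: class_C_eq (class_C_cst _ _ 0) => // x _; by rewrite big_nil.
by apply: class_C_eq (class_CD oU (Cf i) IH) => // x _; rewrite big_cons.
Qed.

Lemma class_C_linear (V W W' : normedModType R) k (U : set V)
    (l : {linear W -> W'}) (f : V -> W) :
  open U -> continuous l -> class_C k U f -> class_C k U (fun x => l (f x)).
Proof.
move=> oU cl; elim: k f => [|k IH] f [df Df].
  by split=> // x Ux; have [] := derive_linear cl (df x Ux).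
split=> [x Ux|v]; first by have [] := derive_linear cl (df x Ux).
apply: class_C_eq (IH _ (Df v)) => // x Ux.
by have [_ ->] := derive_linear cl (df x Ux).
Qed.

Lemma class_CM (V : normedModType R) k (U : set V) (f g : V -> R) :
  open U -> class_C k U f -> class_C k U g -> class_C k U (fun x => f x * g x).
Proof.
move=> oU; elim: k f g => [|k IH] f g Cf Cg; have [df Df] := Cf; have [dg Dg] := Cg.
  by split=> // x Ux; exact: differentiableM (df x Ux) (dg x Ux).
split=> [x Ux|v]; first by exact: differentiableM (df x Ux) (dg x Ux).
have Cf' := class_CW Cf; have Cg' := class_CW Cg.
apply: class_C_eq (class_CD oU (IH _ _ Cf' (Dg v)) (IH _ _ Cg' (Df v))) => // x Ux.
apply/esym; exact: deriveM (diff_derivable (df x Ux)) (diff_derivable (dg x Ux)).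
Qed.

Lemma class_C_coord (V : normedModType R) k (U : set V) m n (i : 'I_m) (j : 'I_n)
    (f : V -> 'M[R]_(m, n)) :
  open U -> class_C k U f -> class_C k U (fun x => f x i j).
Proof.
move=> oU Cf.
have lin : linear (fun N : 'M[R]_(m, n) => N i j : R) by move=> a A B; rewrite !mxE.
pose lM := GRing.isLinear.Build _ _ _ _ _ lin.
pose l : {linear 'M[R]_(m, n) -> R} := HB.pack (fun N : 'M[R]_(m, n) => N i j : R) lM.
exact: (@class_C_linear _ _ _ _ _ l _ oU (@coord_continuous _ _ _ i j) Cf).
Qed.

Lemma class_C_mx (V : normedModType R) k (U : set V) m n (f : V -> 'M[R]_(m, n)) :
  open U -> (forall i j, class_C k U (fun x => f x i j)) -> class_C k U f.
Proof.
move=> oU Cf.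
have Cd i j : class_C k U (fun x => f x i j *: delta_mx i j : 'M[R]_(m, n)).
  have lin : linear (fun a : R => a *: delta_mx i j : 'M[R]_(m, n)).
    by move=> a b c; rewrite scalerDl scalerA.
  pose lM := GRing.isLinear.Build _ _ _ _ _ lin.
  pose l : {linear R -> 'M[R]_(m, n)} :=
    HB.pack (fun a : R => a *: delta_mx i j : 'M[R]_(m, n)) lM.
  apply: (@class_C_linear _ _ _ _ _ l _ oU _ (Cf i j)).
  exact: scalel_continuous.
apply: class_C_eq (class_C_sum oU (fun i => class_C_sum oU (Cd i))) => // x _.
by rewrite [RHS]matrix_sum_delta.
Qed.

End Differentiability.

(** * The smooth function exp(-1/x) for the bump *)

Section FlatFunction.
Variable R : realType.
Implicit Type P : {poly R}.

(** With an arbitrary polynomial in 1/x as factor, the family is closed under differentiation,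
    through [flat_deriv]; smoothness then needs only one derivative for all P. *)
Definition flat P (x : R) : R := if 0 < x then P.[x^-1] * expR (- x^-1) else 0.

Definition flat_deriv P : {poly R} := (P - P^`()) * 'X^2.

(** The quadratic bound makes the difference quotient at 0 tend to 0. *)
Lemma flat_bound P : exists2 C, 0 <= C &
  forall x, `|x| <= 1 -> `|flat P x| <= C * x ^+ 2.
Proof.
pose N := size P.
have pow k (x : R) : (k <= N)%N -> 0 < x <= 1 ->
    (x^-1) ^+ k * expR (- x^-1) <= (N.+2)`!%:R * x ^+ 2.
  move=> kN /andP[x0 x1]; set y := x^-1.
  have y1 : 1 <= y by rewrite /y invf_ge1.
  have y0 : 0 < y by lra.
  (* The two extra powers of y = 1/x, beyond the degree of P, become the factor x^2. *)
  have h : y ^+ N.+2 <= (N.+2)`!%:R * expR y.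
    rewrite mulrC -ler_pdivrMr ?ltr0n ?fact_gt0 //.
    by have := expR_ge1Dxn N.+1 (ltW y0); lra.
  have hk : y ^+ k <= y ^+ N by rewrite ler_weXn2l.
  rewrite expRN ler_pdivrMr ?expR_gt0 //.
  have -> : x ^+ 2 = (y ^+ 2)^-1 by rewrite /y exprVn invrK.
  rewrite mulrAC ler_pdivlMr ?exprn_gt0 //.
  apply: le_trans h; rewrite -[N.+2]addn2 exprD ler_pM2r ?exprn_gt0 //.
exists (\sum_(i < N) `|P`_i| * (N.+2)`!%:R).
  by apply: sumr_ge0 => i _; rewrite mulr_ge0 // ler0n.
move=> x; rewrite ler_norml => /andP[_ x1]; rewrite /flat.
case: ifPn => [x0|_]; last first.
  rewrite normr0 mulr_ge0 ?sqr_ge0 //.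
  by apply: sumr_ge0 => i _; rewrite mulr_ge0 // ler0n.
rewrite horner_coef mulr_suml (le_trans (ler_norm_sum _ _ _)) // mulr_suml.
apply: ler_sum => i _; rewrite !normrM -!mulrA ler_wpM2l //.
rewrite (ger0_norm (expR_ge0 _)) ger0_norm ?exprn_ge0 ?invr_ge0 ?(ltW x0) //.
by apply: pow; rewrite ?x0 //; exact: ltnW.
Qed.

Lemma flat_is_derive P (x : R) : is_derive x 1 (flat P) (flat (flat_deriv P) x).
Proof.
have [x0|x0|x0] := ltgtP 0 x.
- have xn0 : x != 0 by rewrite gt_eqF.
  have dinv := @is_deriveV R id x 1 1 xn0 (is_derive_id x 1).
  have dP := is_derive1_comp (is_derive_poly P x^-1) dinv.
  have dE := @is_derive1_comp R expR (- (fun y : R => y^-1)) x _ _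
    (is_derive_expR (- x^-1)) (is_deriveN dinv).
  have dM := is_deriveM dP dE.
  have nE : \near x, ((horner P \o GRing.inv) *
      (expR \o (- (fun y : R => y^-1)))) x = flat P x.
    apply/near_normP; exists x => // y yx; rewrite /flat.
    have -> : 0 < y by move: yx; rewrite ltr_norml; lra.
    by [].
  apply: (near_eq_is_derive nE).
  apply: is_derive_eq dM _; rewrite /flat x0 /flat_deriv hornerM hornerXn.
  rewrite hornerD hornerN /= /GRing.scale /= !fctE /= expr2.
  by rewrite invfM expr2; ring.
- apply: (near_eq_is_derive (_ : \near x, (cst 0 : R -> R) x = flat P x)).
    apply/near_normP; exists (- x); first by lra.
    move=> y yx; rewrite /flat /cst; case: ifPn => // y0.
    by move: yx; rewrite ltr_norml; lra.
  have -> : flat (flat_deriv P) x = 0 by rewrite /flat ltNge ltW.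
  exact: is_derive_cst.
rewrite -{x}x0 [X in is_derive _ _ _ X]/flat ltxx.
have [C C0 hC] := flat_bound P.
have lim0 : h^-1 *: ((flat P \o shift 0) (h *: 1) - flat P 0) @[h --> 0^'] --> (0 : R).
  apply/cvgrPdist_le => e e0.
  have hn : \forall h \near (0 : R), `|h| <= Num.min 1 (e / (C + 1)).
    apply/near_normP; exists (Num.min 1 (e / (C + 1))).
      by rewrite lt_min ltr01 divr_gt0 //; lra.
    by move=> y; rewrite subr0 => /ltW.
  near=> h; have hn0 : h != 0 by near: h; exact: nbhs_dnbhs_neq.
  have hs : `|h| <= Num.min 1 (e / (C + 1)) by near: h; exact: nbhs_dnbhs hn.
  move: hs; rewrite le_min => /andP[h1 he].
  rewrite sub0r normrN /= addr0 /GRing.scale /= mulr1 [flat P 0]/flat ltxx subr0.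
  rewrite normrM normfV ler_pdivrMl ?normr_gt0 //.
  apply: le_trans (hC _ h1) _; rewrite ler_pdivlMr in he; last by lra.
  rewrite -real_normK ?num_real // expr2.
  by have := normr_ge0 h; nra.
apply: DeriveDef; first by apply/cvg_ex; exists 0.
exact: cvg_lim lim0.
Unshelve. all: by end_near. Qed.

Lemma differentiable_flat P x : differentiable (flat P) x.
Proof. by apply/derivable1_diffP; have [] := flat_is_derive P x. Qed.

Lemma class_C_flat (V : normedModType R) k (U : set V) (f : V -> R) P :
  open U -> class_C k U f -> class_C k U (fun x => flat P (f x)).
Proof.
move=> oU; elim: k f P => [|k IH] f P Cf; have [df Df] := Cf.
  split=> // x Ux.
  by apply: differentiable_comp; [exact: df|exact: differentiable_flat].
split=> [x Ux|v].
  by apply: differentiable_comp; [exact: df|exact: differentiable_flat].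
apply: class_C_eq (class_CM oU (Df v) (IH _ (flat_deriv P) (class_CW Cf))) => // x Ux.
have dflat := differentiable_flat P (f x); have dfx := df x Ux.
have dc := differentiable_comp dfx dflat.
have -> : 'D_v (fun x => flat P (f x)) x = 'd (flat P \o f) x v by exact: deriveE.
rewrite diff_comp //= diff1E // /GRing.scale /= deriveE // derive1E.
by have [_ ->] := flat_is_derive P (f x).
Qed.

Lemma flat1_gt0 x : 0 < x -> 0 < flat 1 x.
Proof. by move=> x0; rewrite /flat x0 hornerC mul1r expR_gt0. Qed.

Lemma flat1_ge0 x : 0 <= flat 1 x.
Proof. by rewrite /flat; case: ifPn => // _; rewrite hornerC mul1r expR_ge0. Qed.

Lemma flat1_le x y : x <= y -> flat 1 x <= flat 1 y.
Proof.
move=> xy; rewrite [flat 1 x]/flat; case: ifPn => [x0|_]; last exact: flat1_ge0.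
rewrite /flat (lt_le_trans x0 xy) !hornerC !mul1r ler_expR lerN2 lef_pV2 ?posrE //.
exact: lt_le_trans xy.
Qed.

End FlatFunction.

(** * Charts *)

Section Charts.
Variables (R : realType) (n : nat).

Section OneChart.
Variables (M : topologicalType) (c : chart R n M).

Lemma cmapKV x : (cmap c @` cdom c) x -> cdom c (cinv c x) /\ cmap c (cinv c x) = x.
Proof. by case=> p cp <-; rewrite cmapK. Qed.

Lemma cinv_continuous_at x : (cmap c @` cdom c) x -> {for x, continuous (cinv c)}.
Proof.
move=> cx; have := cinv_continuous (c := c).
rewrite continuous_open_subspace; last exact: cimg_open.
by apply; rewrite inE.
Qed.

Lemma open_cmap (O : set M) : open O -> open (cmap c @` (cdom c `&` O)).
Proof.
move=> oO; rewrite openE => _ [p [cp Op] <-].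
have cx : (cmap c @` cdom c) (cmap c p) by exists p.
have nO : \forall q \near cinv c (cmap c p), O q.
  by rewrite cmapK //; exact: open_nbhs_nbhs.
have nU := open_nbhs_nbhs (conj (@cimg_open _ _ _ c) cx).
apply: filterS2 nU (near_comp (cinv_continuous_at cx) nO) => x /cmapKV[cx' xE] Ox.
by exists (cinv c x).
Qed.

Lemma near_cinv p (P : M -> Prop) : cdom c p -> (\forall q \near p, P q) ->
  \forall x \near cmap c p, cdom c (cinv c x) /\ cmap c (cinv c x) = x /\ P (cinv c x).
Proof.
move=> cp nP; have cx : (cmap c @` cdom c) (cmap c p) by exists p.
have nP' : \forall q \near cinv c (cmap c p), P q by rewrite cmapK.
have nU := open_nbhs_nbhs (conj (@cimg_open _ _ _ c) cx).
by apply: filterS2 nU (near_comp (cinv_continuous_at cx) nP') => x /cmapKV[].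
Qed.

End OneChart.

Lemma open_trans_dom (M : topologicalType) (c c' : chart R n M) : open (trans_dom c c').
Proof. exact/open_cmap/cdom_open. Qed.

Variable M : smoothManifold R n.
Implicit Types c : chart R n M.

Lemma trans_smooth c c' : atlas c -> atlas c' ->
  smooth_on (trans_dom c c') (trans c c').
Proof. by move=> ac ac'; have [] := atlas_compatible ac ac'. Qed.

Lemma trans_differentiable c c' p : atlas c -> atlas c' -> cdom c p -> cdom c' p ->
  differentiable (trans c c') (cmap c p).
Proof.
move=> ac ac' cp c'p; have sm := trans_smooth ac ac'.
by apply: (sm [::]); exists p.
Qed.

Lemma trans_cmap c c' p : cdom c p -> trans c c' (cmap c p) = cmap c' p.
Proof. by move=> cp; rewrite /trans cmapK. Qed.

Lemma diff_trans_id c p v : atlas c -> cdom c p -> 'd (trans c c) (cmap c p) v = v.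
Proof.
move=> ac cp.
have nid : \forall x \near cmap c p, id x = trans c c x.
  have nT : \forall q \near p, True by exact: filterT.
  by apply: filterS (near_cinv cp nT) => x [_ [xE _]]; rewrite /trans xE.
have [_ ->] := near_eq_differentiable nid (@ex_diff _ _ _ _ _ _ _ (is_diff_id _)).
by rewrite diff_val.
Qed.

Lemma diff_trans_comp c c' c'' p v : atlas c -> atlas c' -> atlas c'' ->
  cdom c p -> cdom c' p -> cdom c'' p ->
  'd (trans c c'') (cmap c p) v =
  'd (trans c' c'') (cmap c' p) ('d (trans c c') (cmap c p) v).
Proof.
move=> ac ac' ac'' cp c'p c''p.
have dc := trans_differentiable ac ac' cp c'p.
have dc' : differentiable (trans c' c'') (trans c c' (cmap c p)).
  by rewrite trans_cmap //; exact: trans_differentiable.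
have nE : \forall x \near cmap c p, (trans c' c'' \o trans c c') x = trans c c'' x.
  have nc' := open_nbhs_nbhs (conj (@cdom_open _ _ _ c') c'p).
  apply: filterS (near_cinv cp nc') => x [cx [xE c'x]] /=.
  by rewrite /trans cmapK.
have dcc := differentiable_comp dc dc'.
have [_ dE] := @near_eq_differentiable _ _ _ _ (trans c c'') _ nE dcc.
have dvE := congr1 (@^~ v) (eq_trans dE (diff_comp dc dc')).
by apply: etrans dvE _; rewrite /= (trans_cmap c' cp).
Qed.

Lemma mul_jacobian m (f : 'rV[R]_n -> 'rV[R]_m) x v :
  v *m jacobian f x = 'd f x v.
Proof. by rewrite /jacobian mul_rV_lin1. Qed.

Lemma jacobian_entry m (f : 'rV[R]_n -> 'rV[R]_m) x i j :
  differentiable f x -> jacobian f x i j = 'D_(delta_mx 0 i) f x 0 j.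
Proof. by move=> df; rewrite deriveEjacobian // -rowE [RHS]mxE. Qed.

Lemma smooth_jacobian_class_C m k (U : set 'rV[R]_n) (f : 'rV[R]_n -> 'rV[R]_m) :
  open U -> smooth_on U f -> class_C k U (fun x => jacobian f x).
Proof.
move=> oU /smooth_onP sf; apply: class_C_mx => // i j.
have [df Df] := sf k.+1.
have := class_C_coord 0 j oU (Df (delta_mx 0 i)).
by apply: class_C_eq => // x Ux; rewrite jacobian_entry //; exact: df.
Qed.

Lemma class_C_continuous (V W : normedModType R) k (U : set V) (f : V -> W) x :
  class_C k U f -> U x -> {for x, continuous f}.
Proof. by case: k => [|k] [df _] Ux; apply: differentiable_continuous; exact: df. Qed.

Lemma near_entry_sum (V : normedModType R) m p (f : V -> 'M[R]_(m, p)) x eps :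
  {for x, continuous f} -> 0 < eps ->
  \forall y \near x, entry_sum (f y - f x) < eps.
Proof.
move=> cf eps0.
have : entry_sum (f y - f x) @[y --> x] --> \sum_(i < m) \sum_(j < p) (0 : R).
  apply: (@cvg_sum _ _ _ _ (nbhs x)) => i; apply: (@cvg_sum _ _ _ _ (nbhs x)) => j.
  rewrite -(normr0 R); apply: cvg_norm.
  rewrite -[0](subrr (f x i j)).
  have -> : (fun y => (f y - f x) i j) = (fun y => f y i j - f x i j).
    by apply/funext => y; rewrite !mxE.
  apply: cvgB; last exact: cvg_cst.
  exact: (cvg_comp _ _ cf (@coord_continuous _ _ _ i j (f x))).
rewrite big1 => [/cvgrPdistC_lt/(_ _ eps0)|i _]; last by rewrite big1.
by apply: filterS => y; rewrite subr0 ger0_norm // entry_sum_ge0.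
Qed.

(** The mean value inequality is applied along a segment to f minus its linear part at x0. Half of
    eta pays for differentiability at the running point, half for the variation of the Jacobian. *)
Lemma smooth_strictly_differentiable m (U : set 'rV[R]_n)
    (f : 'rV[R]_n -> 'rV[R]_m) x0 eta :
  open U -> smooth_on U f -> U x0 -> 0 < eta -> exists2 d, 0 < d &
  forall x x', `|x - x0| < d -> `|x' - x0| < d ->
    `|f x - f x' - (x - x') *m jacobian f x0| <= eta * `|x - x'|.
Proof.
move=> oU sf Ux0 eta0.
have cJ := class_C_continuous (smooth_jacobian_class_C 0 oU sf) Ux0.
have eta2 : 0 < eta / 2 by rewrite divr_gt0.
have /near_normP[d d0 hd] :
    \forall x \near x0, U x /\ entry_sum (jacobian f x - jacobian f x0) < eta / 2.
  by apply: filterS2 (open_nbhs_nbhs (conj oU Ux0)) (near_entry_sum cJ eta2).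
exists d => // x x' xd x'd; pose v := x - x'; pose g (t : R) := x' + t *: v.
have gd t : 0 <= t <= 1 -> `|g t - x0| < d.
  move=> /andP[t0 t1].
  have -> : g t - x0 = t *: (x - x0) + (1 - t) *: (x' - x0).
    by apply/rowP => j; rewrite !mxE; ring.
  rewrite (le_lt_trans (ler_normD _ _)) // !normrZ (ger0_norm t0).
  rewrite ger0_norm ?subr_ge0 //.
  have [->|t0'] := eqVneq t 0; first by rewrite mul0r add0r subr0 mul1r.
  have : 0 < t by rewrite lt_neqAle eq_sym t0'.
  by nra.
pose h (t : R) := f (g t) - t *: (v *m jacobian f x0).
suff : `|h 1 - h 0| <= eta * `|v|.
  rewrite /h /g scale1r scale0r addr0 scale0r subr0 scale1r.
  by rewrite [x' + v]addrC subrK addrAC.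
apply: locally_lipschitz_unit_interval => t t01.
have [Ugt Jgt] := hd _ (gd _ t01).
have dfg : differentiable f (g t) := sf [::] _ Ugt.
have /near_normP[d1 d10 hd1] := differentiable_near_eps dfg eta2.
exists (d1 / (`|v| + 1)) => [|s _ std]; first by rewrite divr_gt0 // ltr_wpDl.
have gB : g s - g t = (s - t) *: v.
  by rewrite /g opprD addrACA subrr add0r -scalerBl.
have regroup (a b u w : 'rV[R]_m) :
    a - s *: w - (b - t *: w) = (a - b - (s - t) *: u) + (s - t) *: (u - w).
  by apply/rowP => j; rewrite !mxE; ring.
have := hd1 (g s); rewrite gB normrZ; have -> : `|s - t| * `|v| < d1.
  rewrite ltr_pdivlMr in std; last by rewrite ltr_wpDl.
  by apply: le_lt_trans std; rewrite ler_wpM2l // lerDl.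
move=> /(_ isT); rewrite linearZ /= -mul_jacobian => h1.
have -> : h s - h t = (f (g s) - f (g t) - (s - t) *: (v *m jacobian f (g t))) +
    (s - t) *: (v *m (jacobian f (g t) - jacobian f x0)).
  by rewrite mulmxBr; exact: regroup.
rewrite (le_trans (ler_normD _ _)) // normrZ.
have h2 := norm_mulmx_le v (jacobian f (g t) - jacobian f x0).
have h3 := ler_wpM2l (normr_ge0 v) (ltW Jgt).
have h4 := ler_wpM2l (normr_ge0 (s - t)) (le_trans h2 h3).
by lra.
Qed.

End Charts.

(** * The twisted metric *)

Section TwistedMetric.
Variables (R : realType) (n q : nat) (M : smoothManifold R n) (g : metric M q)
  (A : set M) (c0 : chart R n M) (x0 : 'rV[R]_n) (L : 'M[R]_(n, q))
  (S : 'M[R]_(n, 2)) (e : 'rV[R]_q) (r C : R).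

(* The columns are the one-forms v |-> (v *m twist x) 0 k, together
   v L + (s dt - t ds)(v) e with (s, t) = (x - x0) S. *)
Definition twist (x : 'rV[R]_n) : 'M[R]_(n, q) :=
  L + S *m (\col_i (if i == 0 then - ((x - x0) *m S) 0 1
                    else ((x - x0) *m S) 0 0) *m e).

Lemma mul_twist v x : v *m twist x =
  v *m L + (((x - x0) *m S) 0 0 * (v *m S) 0 1 -
            ((x - x0) *m S) 0 1 * (v *m S) 0 0) *: e.
Proof.
rewrite mulmxDr; congr (_ + _).
set w := (x - x0) *m S; rewrite !mulmxA -mul_scalar_mx; congr (_ *m e).
apply/matrixP => i j; rewrite !ord1 !mxE big_ord_recl big_ord1 !mxE /=.
have -> : lift ord0 ord0 = 1 :> 'I_2 by apply/val_inj.
by rewrite /=; ring.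
Qed.

Lemma twist_center : twist x0 = L.
Proof.
apply/row_matrixP => i; rewrite !rowE mul_twist subrr mul0mx.
by rewrite !mxE !mul0r subrr scale0r addr0.
Qed.

(** The Euclidean [sqnorm] is used because the max norm is not smooth. *)
Definition radial_bump (x : 'rV[R]_n) : R := C * flat 1 (r ^+ 2 - sqnorm (x - x0)).

Definition cutoff (p : M) : R :=
  if `[< cdom c0 p >] then radial_bump (cmap c0 p) else 0.

(** The pullback of the forms to the chart c. Off [cdom c0] its value is junk, multiplied by a
    vanishing cutoff. *)
Definition twist_at (c : chart R n M) (p : M) : 'M[R]_(n, q) :=
  jacobian (trans c c0) (cmap c p) *m twist (cmap c0 p).

Definition twisted_mx (c : chart R n M) (p : M) : 'M[R]_n :=
  g c p - cutoff p *: (twist_at c p *m (twist_at c p)^T).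

Hypothesis atlas_c0 : atlas c0.
Hypothesis C_ge0 : 0 <= C.
Hypothesis ball_sub : forall x : 'rV[R]_n, sqnorm (x - x0) <= r ^+ 2 ->
  (cmap c0 @` (cdom c0 `&` ~` A)) x.
Hypothesis spacelike_ker : forall p, cdom c0 p -> sqnorm (cmap c0 p - x0) < r ^+ 2 ->
  forall v : 'rV[R]_n, v != 0 -> v *m twist (cmap c0 p) = 0 -> 0 < bform (g c0 p) v v.

Lemma cutoff_ge0 p : 0 <= cutoff p.
Proof. by rewrite /cutoff; case: ifP => // _; rewrite mulr_ge0 // flat1_ge0. Qed.

Lemma cutoff_neq0 p : cutoff p != 0 -> cdom c0 p /\ sqnorm (cmap c0 p - x0) < r ^+ 2.
Proof.
rewrite /cutoff; case: ifPn => [/asboolP c0p|_]; last by rewrite eqxx.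
rewrite /radial_bump /flat subr_gt0; case: ifP => [//|_]; by rewrite mulr0 eqxx.
Qed.

Lemma cutoff_eq0 p : A p -> cutoff p = 0.
Proof.
move=> Ap; apply/eqP/negPn/negP => /cutoff_neq0[c0p /ltW/ball_sub[p' [c0p' nAp'] pE]].
by apply: nAp'; rewrite -(cmapK c0p') pE cmapK.
Qed.

Lemma mul_twist_at c p v :
  v *m twist_at c p = 'd (trans c c0) (cmap c p) v *m twist (cmap c0 p).
Proof. by rewrite mulmxA mul_jacobian. Qed.

Lemma twisted_mx_sym c p : atlas c -> cdom c p ->
  forall v w, bform (twisted_mx c p) v w = bform (twisted_mx c p) w v.
Proof.
by move=> ac cp; apply: bform_sub_gram_sym; exact: (Defs.metric_sym g ac cp).
Qed.

Lemma twisted_mx_nondegenerate_index c p : atlas c -> cdom c p ->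
  nondegenerate_form (twisted_mx c p) /\ has_index (twisted_mx c p) q.
Proof.
move=> ac cp; have [c0p0|/cutoff_neq0[c0p xr]] := eqVneq (cutoff p) 0.
  have -> : twisted_mx c p = g c p by rewrite /twisted_mx c0p0 scale0r subr0.
  by split; [exact: (metric_nondegenerate ac cp)|exact: (metric_index g ac cp)].
apply: perturbed_form_nondegenerate_index.
- exact: (Defs.metric_sym g ac cp).
- exact: (metric_index g ac cp).
- exact: cutoff_ge0.
move=> v v0; rewrite mul_twist_at => vO.
rewrite (metric_trans g ac atlas_c0 cp c0p); apply: spacelike_ker => //.
(* The differential of a transition map is injective because it carries one nondegenerate Gram
   matrix to the other. *)
apply: contraNneq v0 => dv0; apply/eqP/(metric_nondegenerate (m := g) ac cp) => w.
by rewrite (metric_trans g ac atlas_c0 cp c0p) dv0 bform0l.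
Qed.

Lemma twisted_mx_trans c c' p : atlas c -> atlas c' -> cdom c p -> cdom c' p ->
  forall v w : 'rV[R]_n, bform (twisted_mx c p) v w =
    bform (twisted_mx c' p) ('d (trans c c') (cmap c p) v)
                            ('d (trans c c') (cmap c p) w).
Proof.
move=> ac ac' cp c'p v w.
apply: (bform_sub_gram_transfer (metric_trans g ac ac' cp c'p v w)).
have [->|/cutoff_neq0[c0p _]] := eqVneq (cutoff p) 0; first by left.
have h u : u *m twist_at c p = 'd (trans c c') (cmap c p) u *m twist_at c' p.
  have dE := congr1 (mulmx^~ (twist (cmap c0 p)))
    (diff_trans_comp u ac ac' atlas_c0 cp c'p c0p).
  exact: etrans (mul_twist_at c p u) (etrans dE (esym (mul_twist_at c' p _))).
by right; split; exact: h.
Qed.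

Lemma class_C_gram k (U : set 'rV[R]_n) (G : 'rV[R]_n -> 'M[R]_n)
    (a : 'rV[R]_n -> R) (O : 'rV[R]_n -> 'M[R]_(n, q)) :
  open U -> class_C k U G -> class_C k U a -> class_C k U O ->
  class_C k U (fun x => G x - a x *: (O x *m (O x)^T)).
Proof.
move=> oU CG Ca CO; apply: class_C_mx => // i j.
have CS : class_C k U (fun x => \sum_l O x i l * O x j l).
  by apply: class_C_sum => // l; apply: class_CM => //; exact: class_C_coord.
have CN := class_CM oU (class_C_real k U (-1)) (class_CM oU Ca CS).
apply: class_C_eq (class_CD oU (class_C_coord i j oU CG) CN) => // x _.
rewrite !mxE mulN1r; congr (_ - _ * _).
by apply: eq_bigr => l _; rewrite mxE.
Qed.

Lemma class_C_twist k (U : set 'rV[R]_n) (f : 'rV[R]_n -> 'rV[R]_n) :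
  open U -> class_C k U f -> class_C k U (fun x => twist (f x)).
Proof.
move=> oU Cf; apply: class_C_mx => // i j.
have Cs l : class_C k U (fun x => ((f x - x0) *m S) 0 l).
  have CC m : class_C k U (fun x => (f x 0 m + - x0 0 m) * S m l).
    apply: class_CM => //; last exact: class_C_cst.
    by apply: class_CD => //; [exact: class_C_coord|exact: class_C_cst].
  apply: class_C_eq (class_C_sum oU CC) => // x _.
  by rewrite mxE; apply: eq_bigr => m _; rewrite !mxE.
have CN := class_CM oU (class_C_real k U (-1)) (Cs 1).
have CE := class_CM oU (class_CD oU (class_CM oU (class_C_real k U (S i 1)) (Cs 0))
  (class_CM oU (class_C_real k U (S i 0)) CN)) (class_C_real k U (e 0 j)).
apply: class_C_eq (class_CD oU (class_C_real k U (L i j)) CE) => // x _.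
rewrite /twist; set s := ((f x - x0) *m S) 0 0; set t := ((f x - x0) *m S) 0 1.
rewrite !mxE big_ord_recl big_ord1 !mxE !big_ord1 !mxE /=.
have -> : lift ord0 ord0 = 1 :> 'I_2 by apply/val_inj.
by rewrite /=; ring.
Qed.

Lemma class_C_bump k (U : set 'rV[R]_n) (f : 'rV[R]_n -> 'rV[R]_n) :
  open U -> class_C k U f -> class_C k U (fun x => radial_bump (f x)).
Proof.
move=> oU Cf; apply: class_CM => //; first exact: class_C_cst.
apply: class_C_flat => //.
have CC m : class_C k U (fun x => f x 0 m + - x0 0 m).
  by apply: class_CD => //; [exact: class_C_coord|exact: class_C_cst].
have CS := class_C_sum oU (fun m => class_CM oU (CC m) (CC m)).
have CN := class_CM oU (class_C_real k U (-1)) CS.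
apply: class_C_eq (class_CD oU (class_C_real k U (r ^+ 2)) CN) => // x _.
rewrite mulN1r; congr (_ - _); apply: eq_bigr => m _.
by rewrite !mxE expr2.
Qed.

Lemma compact_sqnorm_ball : compact [set x : 'rV[R]_n | sqnorm (x - x0) <= r ^+ 2].
Proof.
have cts : continuous (fun x : 'rV[R]_n => sqnorm (x - x0)).
  move=> x; apply: (@cvg_sum _ _ _ _ (nbhs x)) => j.
  have -> : (fun x : 'rV[R]_n => (x - x0) 0 j ^+ 2) =
      (fun x => (x 0 j - x0 0 j) * (x 0 j - x0 0 j)).
    by apply/funext => y; rewrite !mxE expr2.
  rewrite !mxE expr2.
  have h := differentiable_continuous
    (differentiableB (differentiable_coord x 0 j) (differentiable_cst (x0 0 j) x)).
  exact: (cvgM h h).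
apply: bounded_closed_compact; last first.
  apply: (@closed_comp _ _ (fun x : 'rV[R]_n => sqnorm (x - x0)) [set y | y <= r ^+ 2]).
    by move=> x _; exact: cts.
  exact: closed_le.
exists (`|x0| + `|r|); split=> [|y yr x /= xr]; first exact: num_real.
have h : `|x - x0| <= `|r|.
  rewrite -(ler_pXn2r (n := 2)) ?nnegrE // real_normK ?num_real //.
  exact: le_trans (sqr_norm_le_sqnorm _) xr.
rewrite (le_trans _ (ltW yr)) // -[x](subrK x0) (le_trans (ler_normD _ _)) //.
by rewrite addrC lerD2l.
Qed.

(** The image of a closed ball might accumulate in M outside the chart; compactness and the
    Hausdorff property exclude this. *)
Lemma closed_support : closed (cinv c0 @` [set x | sqnorm (x - x0) <= r ^+ 2]).
Proof.
apply: compact_closed; first exact: msort_hausdorff.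
apply: continuous_compact; last exact: compact_sqnorm_ball.
apply: continuous_subspaceW (@cinv_continuous _ _ _ c0) => x /ball_sub.
by apply: image_subset => p [].
Qed.

Lemma twisted_mx_smooth c : atlas c ->
  smooth_on (cmap c @` cdom c) (fun x => twisted_mx c (cinv c x)).
Proof.
move=> ac vs x cx; have [cp xE] := cmapKV cx.
have gs := metric_smooth g ac.
have [c0p|nc0p] := pselect (cdom c0 (cinv c x)).
  have Ux : trans_dom c c0 x by exists (cinv c x).
  have oU := @open_trans_dom _ _ _ c c0.
  have UW : trans_dom c c0 `<=` cmap c @` cdom c by apply: image_subset => p [].
  (* Smoothness is tested pointwise on a total function, so it may be proved on a smaller open set
     containing x. *)
  move: vs x Ux {cx cp xE c0p}; apply/smooth_onP => k.
  have sT := trans_smooth ac atlas_c0; have /smooth_onP/(_ k) CT := sT.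
  have CG : class_C k (trans_dom c c0) (fun x => g c (cinv c x)).
    by move: k {CT}; apply/smooth_onP => vs x /UW; exact: gs.
  have CJ := smooth_jacobian_class_C k oU sT.
  have CO : class_C k (trans_dom c c0)
      (fun x => jacobian (trans c c0) x *m twist (trans c c0 x)).
    apply: class_C_mx => // i j.
    have Ctw := class_C_twist oU CT.
    have CC l := class_CM oU (class_C_coord i l oU CJ) (class_C_coord l j oU Ctw).
    by apply: class_C_eq (class_C_sum oU CC) => // x _; rewrite mxE.
  have Cgram := class_C_gram oU CG (class_C_bump oU CT) CO.
  apply: (class_C_eq oU _ Cgram) => x Ux.
  have [cp xE] := cmapKV (UW _ Ux).
  have c0p : cdom c0 (cinv c x) by case: Ux => p [cp' c0p] <-; rewrite cmapK.
  have cutE : cutoff (cinv c x) = radial_bump (trans c c0 x).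
    by rewrite /cutoff asboolT.
  have twE : twist_at c (cinv c x) = jacobian (trans c c0) x *m twist (trans c c0 x).
    by rewrite /twist_at xE.
  by rewrite /twisted_mx cutE twE.
(* A point off [cdom c0] has a neighbourhood avoiding the support, where the metric is g. *)
pose K := cinv c0 @` [set x | sqnorm (x - x0) <= r ^+ 2].
have oK : open (~` K) by apply: closed_openC; exact: closed_support.
have oU := open_cmap (c := c) oK.
have Ux : (cmap c @` (cdom c `&` ~` K)) x.
  exists (cinv c x) => //; split=> // -[y /ball_sub[p [c0p _] <-] yE].
  by apply: nc0p; rewrite -yE cmapK.
have UW : cmap c @` (cdom c `&` ~` K) `<=` cmap c @` cdom c.
  by apply: image_subset => p [].
move: vs x Ux {cx cp xE nc0p}; apply/smooth_onP => k.
have CG : class_C k (cmap c @` (cdom c `&` ~` K)) (fun x => g c (cinv c x)).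
  by move: k; apply/smooth_onP => vs x /UW; exact: gs.
apply: class_C_eq CG => // _ [p [cp nKp] <-]; rewrite cmapK // /twisted_mx.
have -> : cutoff p = 0; last by rewrite scale0r subr0.
apply/eqP/negPn/negP => /cutoff_neq0[c0p pr]; apply: nKp.
by exists (cmap c0 p); [exact: ltW|rewrite cmapK].
Qed.

Definition twisted_metric : metric M q :=
  Defs.Metric twisted_mx_sym
    (fun c p ac cp => proj1 (twisted_mx_nondegenerate_index ac cp))
    (fun c p ac cp => proj2 (twisted_mx_nondegenerate_index ac cp))
    twisted_mx_trans twisted_mx_smooth.

Lemma twisted_metric_eq_on : metric_eq_on A g twisted_metric.
Proof.
by move=> c p ac cp Ap; rewrite /= /twisted_mx cutoff_eq0 // scale0r subr0.
Qed.

Lemma twisted_metric_timelike (v : tangent_vector M) :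
  timelike g v -> timelike twisted_metric v.
Proof.
apply: le_lt_trans; rewrite /metric_sq /= bform_sub_gram_diag lerBlDr lerDl.
by rewrite mulr_ge0 ?cutoff_ge0 ?sqnorm_ge0.
Qed.

Lemma twisted_metric_sq (v : tangent_vector M) : tv_chart v = c0 ->
  metric_sq twisted_metric v = bform (g c0 (tv_base v)) (tv_coord v) (tv_coord v) -
    radial_bump (cmap c0 (tv_base v)) *
      sqnorm (tv_coord v *m twist (cmap c0 (tv_base v))).
Proof.
case: v => p c ac cp v /= cE; subst c; rewrite /metric_sq /= bform_sub_gram_diag.
by rewrite /cutoff asboolT // mul_twist_at diff_trans_id.
Qed.

End TwistedMetric.

(** * Foliations without timelike vectors *)

Section Foliations.
Variables (R : realType) (n q : nat).

Definition last_coords : 'M[R]_(n, q) := \matrix_(i, j) (i == (n - q + j)%N :> nat)%:R.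

Lemma eq_transverseP (x y : 'rV[R]_n) : (q <= n)%N ->
  eq_transverse q x y <-> x *m last_coords = y *m last_coords.
Proof.
move=> qn.
have lt_ord (j : 'I_q) : (n - q + j < n)%N by have := ltn_ord j; lia.
have mulE (z : 'rV[R]_n) (j : 'I_q) : (z *m last_coords) 0 j = z 0 (Ordinal (lt_ord j)).
  rewrite mxE (bigD1 (Ordinal (lt_ord j))) //= mxE /= eqxx mulr1 big1 ?addr0 // => i ij.
  rewrite mxE; case: eqP => [iE|_]; last by rewrite mulr0.
  by case/eqP: ij; apply/val_inj.
split=> [xy|xy i iq].
  by apply/rowP => j; rewrite !mulE; apply: xy; rewrite /= leq_addr.
have jq : (i - (n - q) < q)%N by have := ltn_ord i; lia.
have := congr1 (fun z : 'rV[R]_q => z 0 (Ordinal jq)) xy; rewrite !mulE.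
have -> // : Ordinal (lt_ord (Ordinal jq)) = i.
by apply/val_inj; rewrite /= subnKC.
Qed.

Variables (M : smoothManifold R n) (g : metric M q) (c0 : chart R n M).
Variables (x0 : 'rV[R]_n) (V : 'M[R]_(q, n)) (E : 'M[R]_(2, n)) (e : 'rV[R]_q).
Variables (b eps : R).

(** Cutting with a subspace of dimension q + 2 reduces leaves to surfaces, and on it the forms
    become dy + (s dt - t ds) e. *)
Definition slice (z : 'rV[R]_2 * 'rV[R]_q) : 'rV[R]_n := x0 + (z.1 *m E + z.2 *m V).

Lemma sliceB z z' : slice z - slice z' = (z - z').1 *m E + (z - z').2 *m V.
Proof.
rewrite /slice opprD addrACA subrr add0r /=.
by rewrite mulmxBl mulmxBl opprD addrACA.
Qed.

Lemma slice_lipschitz z z' :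
  `|slice z - slice z'| <= (entry_sum E + entry_sum V) * `|z - z'|.
Proof.
rewrite sliceB (le_trans (ler_normD _ _)) // mulrDl.
rewrite lerD // (le_trans (norm_mulmx_le _ _)) // mulrC;
  apply: ler_wpM2l; rewrite ?entry_sum_ge0 //.
  exact: norm_fst_le.
exact: norm_snd_le.
Qed.

Lemma slice_continuous : continuous slice.
Proof.
move=> z; apply/(@cvgrPdistC_lt _ _ _ (nbhs z)) => d d0.
pose N := entry_sum E + entry_sum V + 1.
have N0 : 0 < N by rewrite ltr_wpDl // addr_ge0 // entry_sum_ge0.
suff : \forall z' \near z, `|slice z' - slice z| < d by [].
apply/near_normP; exists (d / N); first by rewrite divr_gt0.
move=> z' zz'; rewrite ltr_pdivlMr // in zz'.
apply: le_lt_trans zz'; apply: le_trans (slice_lipschitz z' z) _.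
by rewrite mulrC ler_wpM2l // lerDl.
Qed.

Hypotheses (qn : (q <= n)%N) (norm_e : `|e| = 1) (b_small : b <= 4^-1)
  (b_gt0 : 0 < b) (eps_gt0 : 0 < eps) (eps_small : eps < b / 24).
Hypothesis atlas_c0 : atlas c0.
Variable U : set M.
Hypothesis slice_in : forall z, `|z| < b -> (cmap c0 @` (cdom c0 `&` U)) (slice z).
Hypothesis pinned : forall z p (c0p : cdom c0 p), `|z| < b -> cmap c0 p = slice z ->
  forall w y, 0 <= metric_sq g (TangentVector atlas_c0 c0p (w *m E + y *m V)) ->
    `|y + det2 z.1 w *: e| <= eps * `|(w, y)|.

(** A kernel vector of the transverse coordinates restricted to the slice is tangent to a leaf, so
    it is not timelike, and [pinned] becomes the cone condition of [twisted_level_sets]. *)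
Lemma pinned_foliation_absurd (F : foliation q U) :
  (forall v : tangent_vector M, tangent_to F v -> ~ timelike g v) -> False.
Proof.
move=> notime.
(* The index set is that of all charts; those outside the foliated atlas get an empty domain. *)
pose D (c : chart R n M) : set ('rV[R]_2 * 'rV[R]_q) :=
  [set z | fol_atlas F c /\ trans_dom c0 c (slice z)].
pose f (c : chart R n M) z := trans c0 c (slice z) *m last_coords.
have inF c : fol_atlas F c -> atlas c by apply: fol_atlas_sub.
apply: (@twisted_level_sets R q (chart R n M) D f b eps e) => //.
- by move: eps_small b_small; lra.
- move=> c; have [Fc|nFc] := pselect (fol_atlas F c); last first.
    have -> : D c = set0 by apply/seteqP; split=> // z [].
    exact: open0.
  have -> : D c = slice @^-1` (trans_dom c0 c) by apply/seteqP; split=> // z [].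
  apply: open_comp; last exact: open_trans_dom.
  by move=> z _; exact: slice_continuous.
- move=> z zb; have [p [c0p Up] pz] := slice_in zb.
  have [c Fc cp] : (\bigcup_(c in fol_atlas F) cdom c) p by rewrite fol_atlas_cover.
  by exists c; split=> //; exists p.
- move=> c c' z [Fc [p [c0p cp] pz]] [Fc' [p' [c0p' c'p] pz']].
  have pE : p' = p by rewrite -(cmapK c0p) pz -pz' cmapK.
  rewrite {}pE {p' c0p' pz'} in c'p *.
  have xd : trans_dom c c' (cmap c p) by exists p.
  have [N nN hN] := fol_atlas_trans Fc Fc' xd.
  have tE : trans c0 c (cmap c0 p) = cmap c p by rewrite trans_cmap.
  have ct := differentiable_continuous
    (trans_differentiable atlas_c0 (inF _ Fc) c0p cp).
  have nN' : \forall x \near trans c0 c (cmap c0 p), N x by rewrite tE.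
  have nN2 := near_comp ct nN'.
  have ncp := open_nbhs_nbhs (conj (@cdom_open _ _ _ c) cp).
  have nc := near_cinv c0p ncp.
  have nz : \forall x \near slice z, N (trans c0 c x) /\ cdom c (cinv c0 x).
    by rewrite -pz; apply: filterS2 nN2 nc => x Nx [_ [_ cx]].
  apply: filterS (near_comp (@slice_continuous z) nz) => z' [Nz' cz'].
  move=> /(eq_transverseP _ _ qn) fE; apply/(eq_transverseP _ _ qn).
  have Nz : N (trans c0 c (slice z)) by rewrite -pz tE; exact: nbhs_singleton.
  have := hN _ _ Nz' Nz fE.
  have t2 x : cdom c (cinv c0 x) -> trans c c' (trans c0 c x) = trans c0 c' x.
    by move=> cx; rewrite /trans cmapK.
  by rewrite !t2 // -pz cmapK.
move=> c z zb [Fc zd]; have [p [c0p cp] pz] := zd.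
have ac := inF _ Fc.
pose J := jacobian (trans c0 c) (slice z).
(* The chain rule for the slice, the transition map and the projection to the last q coordinates. *)
exists (E *m J *m last_coords), (V *m J *m last_coords); split.
  move=> eta eta0; pose N := entry_sum E + entry_sum V.
  have N0 : 0 <= N by rewrite addr_ge0 // entry_sum_ge0.
  pose K := entry_sum last_coords; have K0 : 0 <= K := entry_sum_ge0 _.
  have NK0 : 0 <= N * K by exact: mulr_ge0.
  pose eta' := eta / (N * K + 1).
  have eta'0 : 0 < eta' by rewrite divr_gt0 // ltr_wpDl.
  have etaE : eta' * (N * K + 1) = eta by rewrite divfK // lt0r_neq0 // ltr_wpDl.
  have [d d0 hd] := smooth_strictly_differentiable (@open_trans_dom _ _ _ c0 c)
    (trans_smooth atlas_c0 ac) zd eta'0.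
  have := slice_continuous (x := z).
  move=> /cvgrPdistC_lt/(_ _ d0)/near_normP[d1 d10 hd1].
  exists d1 => // z1 z2 z1d z2d.
  have h := hd _ _ (hd1 _ z1d) (hd1 _ z2d).
  have factor u v w y : u *m last_coords - v *m last_coords -
      (w *m (E *m J *m last_coords) + y *m (V *m J *m last_coords)) =
      (u - v - (w *m E + y *m V) *m J) *m last_coords.
    by rewrite !mulmxBl !mulmxDl !mulmxA.
  have -> : f c z1 - f c z2 - ((z1 - z2).1 *m (E *m J *m last_coords) +
      (z1 - z2).2 *m (V *m J *m last_coords)) =
      (trans c0 c (slice z1) - trans c0 c (slice z2) - (slice z1 - slice z2) *m J)
        *m last_coords.
    by rewrite sliceB; exact: factor.
  apply: le_trans (norm_mulmx_le _ _) _; rewrite -/K.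
  have h1 := ler_wpM2r K0 h.
  have h2 := ler_wpM2l (mulr_ge0 (ltW eta'0) K0) (slice_lipschitz z1 z2).
  rewrite -/N in h2; have := mulr_ge0 (ltW eta'0) (normr_ge0 (z1 - z2)).
  by rewrite -etaE; lra.
move=> w y AE; have pin := @pinned z p c0p zb pz w y.
  apply: pin; rewrite leNgt; apply/negP.
apply: (notime (TangentVector atlas_c0 c0p (w *m E + y *m V))).
exists c; split=> //; apply/(eq_transverseP _ _ qn).
rewrite mul0mx /tv_coord_in /= -mul_jacobian pz -AE.
by rewrite -/J !mulmxDl !mulmxA.
Qed.

End Foliations.

(** * Choice of the constants and conclusion *)

Theorem theorem0p1 (R : realType) (n q : nat) (M : smoothManifold R n)
    (g : metric M q) (A : set M) :
  (1 <= q)%N -> (q <= n - 2)%N ->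
  closed A -> A <> [set: M] ->
  exists g' : metric M q,
    [/\ metric_eq_on A g g',
        (forall v : tangent_vector M, timelike g v -> timelike g' v),
        ~ (exists F : foliation q (~` A),
             forall v : tangent_vector M, tangent_to F v -> ~ timelike g' v)
      & ~ (exists F : foliation q [set: M], space_foliation g' F)].
Proof.
move=> q1 qn clA AT.
have [p0 nAp0] : exists p, ~ A p.
  by apply/existsNP => allA; apply: AT; apply/seteqP; split.
have [c0 ac0 c0p0] := atlas_cover p0; pose x0 := cmap c0 p0.
have [L [V [E [S [K [VL EL VS ES posK]]]]]] := nondegenerate_form_splitting
  (Defs.metric_sym g ac0 c0p0) (metric_nondegenerate ac0 c0p0)
  (metric_index g ac0 c0p0) q1 qn.
pose e : 'rV[R]_q := delta_mx 0 (Ordinal q1).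
have norm_e : `|e| = 1 := norm_delta_mx _ _.
pose tw := twist x0 L S e; have tw0 : tw x0 = L := twist_center _ _ _ _.
pose G x := g c0 (cinv c0 x); have Gp p : cdom c0 p -> G (cmap c0 p) = g c0 p.
  by move=> c0p; rewrite /G cmapK.
pose U0 := cmap c0 @` cdom c0; have oU0 : open U0 := @cimg_open _ _ _ c0.
have U0x0 : U0 x0 by exists p0.
have /smooth_onP/(_ 0%N) CG : smooth_on U0 G := metric_smooth g ac0.
have Cid : class_C 0 U0 (@id 'rV[R]_n) by split=> // x _; exact: ex_diff.
(* H is G + K tw tw^T. It is positive definite at x0, hence nearby, and equals G on the kernel of
   tw; this gives [spacelike_ker]. *)
pose H x := G x - (- K) *: (tw x *m (tw x)^T).
have CH : class_C 0 U0 H.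
  exact: (class_C_gram oU0 CG (class_C_real _ _ _) (class_C_twist _ _ _ _ oU0 Cid)).
have H0 : H x0 = g c0 p0 + K *: (L *m L^T).
  by rewrite /H tw0 Gp // scaleNr opprK.
have [m m_gt0 hm] := posdef_lower_bound posK.
have nH := near_entry_sum (class_C_continuous CH U0x0) m_gt0.
have nG := near_entry_sum (class_C_continuous CG U0x0) ltr01.
have oA : open (~` A) by exact: closed_openC.
have nA : \forall x \near x0, (cmap c0 @` (cdom c0 `&` ~` A)) x.
  by apply: open_nbhs_nbhs; split; [exact: open_cmap|exists p0].
have /near_normP[rho rho_gt0 hrho] : \forall x \near x0,
    [/\ entry_sum (H x - H x0) < m, entry_sum (G x - G x0) < 1 &
        (cmap c0 @` (cdom c0 `&` ~` A)) x].
  by apply: filterS3 nH nG nA => x.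
pose r := rho / 2; have r_gt0 : 0 < r by rewrite divr_gt0.
have in_rho x : sqnorm (x - x0) <= r ^+ 2 -> `|x - x0| < rho.
  move=> xr; have : `|x - x0| <= r.
    rewrite -(ler_pXn2r (n := 2)) ?nnegrE //; last exact: ltW.
    exact: le_trans (sqr_norm_le_sqnorm _) xr.
  by rewrite /r; move: rho_gt0; lra.
have ball_sub (x : 'rV[R]_n) : sqnorm (x - x0) <= r ^+ 2 ->
    (cmap c0 @` (cdom c0 `&` ~` A)) x.
  by move=> /in_rho/hrho[].
have spacelike_ker p : cdom c0 p -> sqnorm (cmap c0 p - x0) < r ^+ 2 ->
    forall v : 'rV[R]_n, v != 0 -> v *m tw (cmap c0 p) = 0 -> 0 < bform (g c0 p) v v.
  move=> c0p /ltW/in_rho/hrho[hH _ _] v v0 vtw.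
  have -> : bform (g c0 p) v v = bform (H (cmap c0 p)) v v.
    by rewrite bform_sub_gram_diag vtw sqnorm0 mulr0 subr0 Gp.
  have -> : H (cmap c0 p) = H x0 + (H (cmap c0 p) - H x0) by rewrite addrC subrK.
  rewrite bform_addmx; have := hm v; rewrite -H0 => h1.
  have := norm_bform_le (H (cmap c0 p) - H x0) v; rewrite ler_norml => /andP[h2 _].
  have v2 : 0 < `|v| ^+ 2 by rewrite exprn_gt0 // normr_gt0.
  by move: hH; rewrite -(ltr_pM2r v2); lra.
pose N := entry_sum E + entry_sum V.
have N_ge0 : 0 <= N by rewrite addr_ge0 // entry_sum_ge0.
have nN_gt0 : 0 < n%:R * N + 1 by rewrite ltr_wpDl // mulr_ge0.
(* The second bound puts the slice over the box in the region where [sqnorm] is at most r^2/2; there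
   the bump is at least C m0. *)
pose b := Num.min 4^-1 (r / (2 * (n%:R * N + 1))).
have b_gt0 : 0 < b.
  rewrite lt_min invr_gt0 ltr0n /= divr_gt0 //.
  by rewrite mulr_gt0.
have b_small : b <= 4^-1 by rewrite ge_min lexx.
have bN : n%:R * N * b <= r / 2.
  have : b <= r / (2 * (n%:R * N + 1)) by rewrite ge_min lexx orbT.
  by rewrite ler_pdivlMr ?mulr_gt0 //; move: b_gt0; lra.
pose Gam := entry_sum (G x0) + 1.
have Gam_ge0 : 0 <= Gam by rewrite addr_ge0 // entry_sum_ge0.
pose m0 := flat 1 (r ^+ 2 / 2).
have m0_gt0 : 0 < m0 by apply: flat1_gt0; rewrite divr_gt0 // exprn_gt0.
pose eps := b / 48; have eps_gt0 : 0 < eps by rewrite divr_gt0.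
have eps_small : eps < b / 24 by rewrite /eps; move: b_gt0; lra.
(* If g'(v, v) >= 0, then C m0 |u|^2 <= Gam N^2 |(w, y)|^2, where u is the value of the forms on v.
   This C makes the right side at most C m0 (eps |(w, y)|)^2. *)
pose C := (Gam * N ^+ 2 + 1) / (m0 * eps ^+ 2).
have GN_ge0 : 0 <= Gam * N ^+ 2 by rewrite mulr_ge0 // sqr_ge0.
have me_gt0 : 0 < m0 * eps ^+ 2 by rewrite mulr_gt0 // exprn_gt0.
have C_gt0 : 0 < C by rewrite divr_gt0 // ltr_wpDl.
have CE : C * m0 * eps ^+ 2 = Gam * N ^+ 2 + 1.
  by rewrite -mulrA divfK // lt0r_neq0.
pose g' := twisted_metric ac0 (ltW C_gt0) ball_sub spacelike_ker.
pose Z := slice x0 V E.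
have Z0 : Z 0 = x0 by rewrite /Z /slice /= !mul0mx !addr0.
have Z_le z : `|Z z - x0| <= N * `|z|.
  by have := slice_lipschitz x0 V E z 0; rewrite -/Z Z0 subr0.
have Z_sqnorm z : `|z| < b -> sqnorm (Z z - x0) <= r ^+ 2 / 2.
  move=> zb; apply: le_trans (sqnorm_le _) _.
  have n1 : 1 <= (n%:R : R) by rewrite ler1n; clear -q1 qn; lia.
  have t0 := normr_ge0 (Z z - x0).
  have h1 : n%:R * `|Z z - x0| <= r / 2.
    apply: le_trans bN; rewrite -mulrA ler_wpM2l //.
    by apply: le_trans (Z_le z) _; rewrite ler_wpM2l // ltW.
  have h2 : (n%:R * `|Z z - x0|) ^+ 2 <= (r / 2) ^+ 2.
    by rewrite ler_pXn2r ?nnegrE ?mulr_ge0 // ltW // divr_gt0.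
  have h3 : n%:R * `|Z z - x0| ^+ 2 <= (n%:R * `|Z z - x0|) ^+ 2.
    by rewrite exprMn ler_wpM2r ?sqr_ge0 // expr2 ler_peMl.
  have r2 : 0 <= r ^+ 2 := sqr_ge0 r.
  by move: (le_trans h3 h2); rewrite exprMn; lra.
have pinned z p (c0p : cdom c0 p) : `|z| < b -> cmap c0 p = Z z ->
    forall w y, 0 <= metric_sq g' (TangentVector ac0 c0p (w *m E + y *m V)) ->
    `|y + det2 z.1 w *: e| <= eps * `|(w, y)|.
  move=> zb pz w y; rewrite twisted_metric_sq //=; set v := w *m E + y *m V.
  have zr := Z_sqnorm _ zb.
  have vtw : v *m twist x0 L S e (cmap c0 p) = y + det2 z.1 w *: e.
    have vL : v *m L = y by rewrite mulmxDl -!mulmxA EL VL mulmx0 mulmx1 add0r.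
    have vS : v *m S = w by rewrite mulmxDl -!mulmxA ES VS mulmx0 mulmx1 addr0.
    have zS : (cmap c0 p - x0) *m S = z.1.
      rewrite pz /Z /slice [x0 + _]addrC addrK.
      by rewrite mulmxDl -!mulmxA ES VS mulmx0 mulmx1 addr0.
    by rewrite mul_twist vL vS zS.
  rewrite vtw; set u := y + _ => sq_ge0.
  have v_le : `|v| <= N * `|(w, y)|.
    have := Z_le (w, y); rewrite /Z /slice /=.
    by rewrite [x0 + _]addrC addrK.
  have r2 : 0 <= r ^+ 2 := sqr_ge0 r.
  have xr : sqnorm (cmap c0 p - x0) <= r ^+ 2 by rewrite pz; lra.
  have Gv : bform (g c0 p) v v <= Gam * `|v| ^+ 2.
    have [_ hG _] := hrho _ (in_rho _ xr).
    have -> : g c0 p = G x0 + (G (cmap c0 p) - G x0) by rewrite Gp // addrC subrK.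
    rewrite bform_addmx mulrDl mul1r lerD //.
      exact: le_trans (ler_norm _) (norm_bform_le _ _).
    apply: le_trans (ler_norm _) (le_trans (norm_bform_le _ _) _).
    by rewrite ler_piMl ?sqr_ge0 // ltW.
  have bump_ge : C * m0 <= radial_bump x0 r C (cmap c0 p).
    rewrite /radial_bump ler_wpM2l ?(ltW C_gt0) // flat1_le // pz; lra.
  have h1 : C * m0 * `|u| ^+ 2 <= radial_bump x0 r C (cmap c0 p) * sqnorm u.
    rewrite ler_pM ?sqr_ge0 ?sqr_norm_le_sqnorm //.
    by rewrite mulr_ge0 // ltW.
  have h2 : Gam * `|v| ^+ 2 <= Gam * (N * `|(w, y)|) ^+ 2.
    by rewrite ler_wpM2l // ler_pXn2r ?nnegrE // mulr_ge0.
  have h3 : C * m0 * `|u| ^+ 2 <= C * m0 * (eps * `|(w, y)|) ^+ 2.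
    have wy2 : 0 <= `|(w, y)| ^+ 2 by exact: sqr_ge0.
    have -> : C * m0 * (eps * `|(w, y)|) ^+ 2 = (Gam * N ^+ 2 + 1) * `|(w, y)| ^+ 2.
      by rewrite -CE; ring.
    by move: h2; rewrite exprMn mulrA; lra.
  have Cm_gt0 : 0 < C * m0 by rewrite mulr_gt0.
  rewrite (ler_pM2l Cm_gt0) in h3.
  by rewrite -(ler_pXn2r (n := 2)) ?nnegrE // mulr_ge0 // ltW.
have slice_in (U : set M) : ~` A `<=` U -> forall z, `|z| < b ->
    (cmap c0 @` (cdom c0 `&` U)) (Z z).
  move=> AU z zb; have [|p [c0p nAp] pz] := ball_sub (Z z).
    by have := Z_sqnorm _ zb; have := sqr_ge0 r; lra.
  by exists p => //; split=> //; exact: AU.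
have qn' : (q <= n)%N by clear -qn; lia.
(* U is any set containing the complement of A, so that foliations of this complement and of M are
   treated together. *)
have nofol U (F : foliation q U) : ~` A `<=` U ->
    (forall v : tangent_vector M, tangent_to F v -> ~ timelike g' v) -> False.
  move=> /slice_in hU.
  exact: (pinned_foliation_absurd qn' norm_e b_small b_gt0 eps_gt0 eps_small hU pinned).
exists g'; split.
- exact: twisted_metric_eq_on.
- exact: twisted_metric_timelike.
- by move=> [F]; exact: nofol.
move=> [F spF]; apply: (nofol _ F) => // v Fv.
have [v0|v0] := eqVneq (tv_coord v) 0.
  by rewrite /timelike /metric_sq v0 bform0l ltxx.
have := spF v Fv v0; rewrite /spacelike /timelike => sp tl.
by have := lt_trans sp tl; rewrite ltxx.
Qed.
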